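(* There exists a deterministic online algorithm for the online single-sink buy-at-bulk problem (in the model where the metric is not known in advance) whose competitive ratio is $O(\log k)$, where $k$ is the number of terminals: for every instance, the cost of the algorithm's solution is at most $O(\log k)\cdot \mathrm{OPT}$.
   Context: Online single-sink (uniform) buy-at-bulk problem: there is a metric space $(V,d)$ and a root $r\in V$. There are $M$ cable types; type $i$ has a fixed cost $\sigma_i\ge 0$ and an incremental cost $\beta_i\ge 0$, with $\sigma_i>\sigma_{i-1}$ and $\beta_i<\beta_{i-1}$. Routing $x$ units of demand through a cable of type $i$ installed on an edge $e=(u,w)$ costs $(\sigma_i+\beta_i x)\,d(e)$. Terminals (points of $V$), each with one unit of demand that must be sent to $r$, arrive one at a time; the metric is not known in advance: when a terminal arrives, only then are its distances to $r$ and to the previously arrived terminals revealed. When a terminal $v$ arrives, the algorithm irrevocably installs cables (possibly several types on the same edge) on some edges and irrevocably chooses a single path $P(v)$ from $v$ to $r$ along which $v$'s unit demand is routed unsplittably; on each edge of $P(v)$ the demand uses the installed cable of highest type. If $\mathrm{load}_i(e)$ denotes the total demand routed through cable type $i$ on edge $e$, the total cost is $\sum_e d(e)\sum_{i:\mathrm{load}_i(e)>0}(\sigma_i+\beta_i\,\mathrm{load}_i(e))$. $\mathrm{OPT}$ denotes the minimum cost of any (offline) solution routing all the terminals' demands to $r$. $k$ denotes the number of terminals that have arrived. *)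

(* Defs.v *)
From HB Require Import structures.
From mathcomp Require Import all_boot all_order all_algebra.
From mathcomp Require Import all_classical all_reals all_analysis.

Set Implicit Arguments.
Unset Strict Implicit.
Unset Printing Implicit Defensive.

Import Order.TTheory GRing.Theory Num.Theory.
Import numFieldNormedType.Exports.

Local Open Scope classical_set_scope.
Local Open Scope ring_scope.

Record cable_types (R : realType) := CableTypes {
  ntypes : nat;
  sigma : 'I_ntypes -> R;
  beta : 'I_ntypes -> R;
  ntypes_gt0 : (0 < ntypes)%N;
  sigma_ge0 : forall i, 0 <= sigma i;
  beta_ge0 : forall i, 0 <= beta i;
  sigma_incr : forall i j : 'I_ntypes, (i < j)%N -> sigma i < sigma j;
  beta_decr : forall i j : 'I_ntypes, (i < j)%N -> beta j < beta i }.

(* What is fixed irrevocably when a terminal v arrives: the cables (u, w, i)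
   newly installed (type i on the edge uw), and the path v :: route from v to
   the root, stored without its first vertex as in path.v. *)
Record decision (V : Type) (M : nat) := Decision {
  cables : seq (V * V * 'I_M);
  route : seq V }.

Definition idle (V : Type) (M : nat) : decision V M := Decision [::] [::].

Definition map_decision (V W : Type) (M : nat) (f : V -> W)
    (D : decision V M) : decision W M :=
  Decision [seq (f c.1.1, f c.1.2, c.2) | c <- cables D]
           [seq f x | x <- route D].

(* Edges are undirected: the edge uw is a representative of the unordered pair
   {u, w}, chosen independently of the orientation (edgeC). *)
Definition edge (V : choiceType) (u w : V) : V * V :=
  choose (pred2 (u, w) (w, u)) (u, w).

Lemma edgeC (V : choiceType) (u w : V) : edge u w = edge w u.
Proof.
rewrite /edge (@eq_choose _ _ (pred2 (w, u) (u, w))); last first.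
  by move=> e /=; rewrite orbC.
by apply: choose_id; rewrite /= eqxx ?orbT.
Qed.

Definition path_edges (V : choiceType) (v : V) (p : seq V) : seq (V * V) :=
  pairmap (@edge V) v p.

Section Solutions.
Context (R : realType) (K : cable_types R) (V : metricType R).

Definition edge_length (e : V * V) : R := mdist e.1 e.2.

Lemma edge_lengthE (u w : V) : edge_length (edge u w) = mdist u w.
Proof.
rewrite /edge_length /edge.
have /= := @chooseP _ (pred2 (u, w) (w, u)) (u, w).
by rewrite eqxx => /(_ isT) /orP[] /eqP-> //=; rewrite metric_sym.
Qed.

(* The terminals are s = [:: s_0; ...; s_(k-1)] in order of arrival (possibly
   with repeated points), r is the root, and D lists one decision per
   terminal. *)
Context (r : V) (s : seq V) (D : seq (decision V (ntypes K))).

Definition route_edges (t : nat) : seq (V * V) :=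
  path_edges (nth r s t) (route (nth (idle V (ntypes K)) D t)).

(* The cables available to terminal t are those of the decisions 0, ..., t. *)
Definition installed (t : nat) (e : V * V) (i : 'I_(ntypes K)) : bool :=
  [exists t' : 'I_t.+1,
     has (fun c => (edge c.1.1 c.1.2 == e) && (c.2 == i))
         (cables (nth (idle V (ntypes K)) D t'))].

Definition highest_installed (t : nat) (e : V * V) (i : 'I_(ntypes K)) : bool :=
  installed t e i && [forall j, installed t e j ==> (j <= i)%N].

Definition solution : Prop :=
  size D = size s /\
  forall t, (t < size s)%N ->
    let v := nth r s t in
    let p := route (nth (idle V (ntypes K)) D t) in
    [/\ uniq (v :: p), last v p = r &
        forall e, e \in route_edges t -> exists i, installed t e i].

Definition load (e : V * V) (i : 'I_(ntypes K)) : nat :=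
  count (fun t => (e \in route_edges t) && highest_installed t e i)
        (iota 0 (size s)).

(* Edges on no route have no load, so it suffices to sum over the others. *)
Definition cost : R :=
  \sum_(e <- undup (flatten [seq route_edges t | t <- iota 0 (size s)]))
    edge_length e *
    \sum_(i | (0 < load e i)%N) (sigma i + beta i * (load e i)%:R).

End Solutions.

(* An offline solution makes its decisions knowing the whole instance, and may
   route through any point of V. *)
Definition opt (R : realType) (K : cable_types R) (V : metricType R)
    (r : V) (s : seq V) : R :=
  inf [set cost r s D | D in [set D : seq (decision V (ntypes K)) |
                              solution r s D]].

(* When the n-th terminal arrives, the algorithm sees the cable types and the
   distances between the n.+1 points revealed so far, which it names by
   'I_n.+1: index 0 is the root and index i > 0 the i-th terminal.  Its earlier
   decisions are determined by submatrices of this matrix. *)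
Definition online_algorithm (R : realType) :=
  forall (K : cable_types R) (n : nat),
    'M[R]_n.+1 -> decision 'I_n.+1 (ntypes K).

Definition revealed (R : realType) (V : metricType R) (r : V) (s : seq V)
    (n : nat) : 'M[R]_n.+1 :=
  \matrix_(i, j) mdist (nth r (r :: s) i) (nth r (r :: s) j).

Definition run (R : realType) (A : online_algorithm R) (K : cable_types R)
    (V : metricType R) (r : V) (s : seq V) : seq (decision V (ntypes K)) :=
  mkseq (fun t => map_decision (fun i : 'I_t.+2 => nth r (r :: s) i)
                               (A K t.+1 (revealed r s t.+1)))
        (size s).

Definition competitive (R : realType) (A : online_algorithm R)
    (rho : nat -> R) : Prop :=
  forall (K : cable_types R) (V : metricType R) (r : V) (s : seq V),
    solution r s (run A K r s) /\
    cost r s (run A K r s) <= rho (size s) * opt K r s.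

(* Main.v *)
(** Cable types are thinned so that consecutive fixed costs grow, and
    consecutive slopes shrink, by a factor 8; this loses a constant factor.
    For every remaining type [l] the algorithm maintains a net of open points.
    An open point of scale [E] accepts connections of length at most [E / 4].
    For each [l], an arriving terminal [v] has a reach [D], its distance to the
    nearest open point of net [l] accepting it, and a scale, the power of two
    [E = up2 D].  It opens as soon as enough terminals of scale [E] lie within
    [E / 16] of it to pay, each at a rate [b_l] per unit of length, for a cable
    of type [l] of length [E].  Open points of equal scale are far apart, so no
    terminal pays twice, and all fixed costs are covered by the sums of
    [b_l * E].

    Inside net [l] scales double along parent pointers.  A demand climbs until
    its distance to net [l + 1] is at most 8 times the current scale, and then
    jumps to net [l + 1].  The length of this path is at most 3 times the
    initial distance to net [l + 1], and the direct edges bought by one open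
    point have geometrically decreasing lengths.

    Conversely, fix [l] and a scale [E], and let [S] be the terminals of that
    scale.  In any solution each [v] in [S] leaves the ball of radius [E / 32]
    around it.  Since [b_l] times the number of points of [S] in such a ball is
    [O(sigma_l)], the routes of [S] near their origins charge an edge [e] with
    [n_e] users at most [O(min (sigma_l, b_l n_e))] times its length, so that
    [b_l E |S| = O(sum_e d(e) min (sigma_l, b_l n_e))].  Only [log k] scales
    matter for each [l], and, the types being geometric, the sum over [l] of
    [min (sigma_l, b_l n)] is [O(sigma_q + beta_q n)] for every type [q]. *)

Require Import Defs.
From mathcomp Require Import all_boot all_order all_algebra.
From mathcomp Require Import all_classical all_reals all_analysis.
From mathcomp Require Import ring lra zify.

Set Implicit Arguments.
Unset Strict Implicit.
Unset Printing Implicit Defensive.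

Import Order.TTheory GRing.Theory Num.Theory.
Import numFieldNormedType.Exports.

Local Open Scope classical_set_scope.
Local Open Scope ring_scope.

(** * Powers of two *)

Section PowersOfTwo.
Context {R : realType}.
Implicit Types (x y a : R).

Definition pow2 x := exists z : int, x = 2 ^ z.

(** Rounding up to a power of two. Nonpositive [x] gives 0, so that points at distance 0 from the
    points accepting them have scale 0. *)
Definition up2 x : R := if 0 < x then 2 ^ Num.ceil (ln x / ln 2) else 0.

Lemma pow2_gt0 x : pow2 x -> 0 < x.
Proof. by case=> z ->; apply: exprz_gt0. Qed.

Lemma pow2M (n : nat) x : pow2 x -> pow2 (2 ^+ n * x).
Proof.
case=> z ->; exists (n%:Z + z).
by rewrite expfzDr ?pnatr_eq0.
Qed.

Lemma pow2_half (n : nat) x : pow2 x -> pow2 (x / 2 ^+ n).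
Proof.
case=> z ->; exists (z - n%:Z).
by rewrite expfzDr ?pnatr_eq0 // -invr_expz.
Qed.

Lemma pow2_lt x y : pow2 x -> pow2 y -> x < y -> 2 * x <= y.
Proof.
case=> z -> [w ->]; rewrite ltr_eXz2l ?ltr1n // => zw.
rewrite -{1}(expr1z 2) -expfzDr ?pnatr_eq0 // ler_eXz2l ?ltr1n //.
by rewrite addrC lezD1.
Qed.

Lemma up2P x : 0 < x -> pow2 (up2 x).
Proof. by move=> x0; rewrite /up2 x0; eexists. Qed.

Lemma up2_npos x : x <= 0 -> up2 x = 0.
Proof. by rewrite /up2 leNgt => /negbTE->. Qed.

Lemma up2_ge x : x <= up2 x.
Proof.
rewrite /up2; case: ltP => // x0.
have l2 : (0 : R) < ln 2 by rewrite ln_gt0 // ltr1n.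
rewrite -[leRHS]lnK; last by rewrite posrE exprz_gt0.
rewrite -[leLHS]lnK ?posrE // ler_expR -powR_intmul // ln_powR.
by rewrite -ler_pdivrMr // ceil_ge.
Qed.

Lemma up2_lt x : 0 < x -> up2 x < 2 * x.
Proof.
move=> x0; rewrite /up2 x0.
have l2 : (0 : R) < ln 2 by rewrite ln_gt0 // ltr1n.
rewrite -[ltLHS]lnK; last by rewrite posrE exprz_gt0.
rewrite -[ltRHS]lnK ?posrE ?mulr_gt0 // ltr_expR -powR_intmul // ln_powR.
rewrite lnM ?posrE // -ltr_pdivlMr // mulrDl divff ?gt_eqF // addrC.
have := ceilB1_lt (ln x / ln 2).
by rewrite intrD ltrBlDr.
Qed.

Lemma up2_gt0 x : (0 < up2 x) = (0 < x).
Proof.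
apply/idP/idP => [|x0]; last exact/pow2_gt0/up2P.
by rewrite /up2; case: (ltP 0 x) => //; rewrite ltxx.
Qed.

Lemma up2_ge0 x : 0 <= up2 x.
Proof.
by case: (ltP 0 x) => x0; rewrite ?(up2_npos x0) // ltW // up2_gt0.
Qed.

Lemma up2_le x a : pow2 a -> x <= a -> up2 x <= a.
Proof.
move=> pa xa; case: (ltP 0 x) => x0; last by rewrite up2_npos // ltW ?pow2_gt0.
rewrite leNgt; apply/negP => /(pow2_lt pa (up2P x0)).
by have := up2_lt x0; lra.
Qed.

Lemma sum_halving (s : seq R) a :
  path (fun x y => 2 * y <= x) a s -> 0 <= a -> all (fun x => 0 <= x) s ->
  \sum_(x <- s) x <= a.
Proof.
elim: s a => [|x s IH] a /=; first by rewrite big_nil.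
case/andP=> xa ps a0 /andP[x0 s0]; rewrite big_cons.
by have := IH _ ps x0 s0; lra.
Qed.

(** In decreasing order, distinct powers of two at least halve from one to the next, so
    [sum_halving] applies with [2 * a] in front. *)
Lemma sum_uniq_pow2 (s : seq R) a :
  uniq s -> 0 <= a -> {in s, forall x, pow2 x /\ x <= a} ->
  \sum_(x <- s) x <= 2 * a.
Proof.
move=> us a0 Hs; have ps : perm_eq s (rev (sort <=%O s)).
  by rewrite perm_sym perm_rev perm_sort.
rewrite (perm_big _ ps) /=.
have {}Hs : {in rev (sort <=%O s), forall x, pow2 x /\ x <= a}.
  by move=> x; rewrite -(perm_mem ps) => /Hs.
apply: sum_halving => /=; last 2 first.
- by rewrite mulr_ge0.
- by apply/allP => x /Hs[/pow2_gt0/ltW].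
have : sorted (fun x y => y < x) (rev (sort <=%O s)).
  by rewrite rev_sorted sort_lt_sorted.
move: Hs; case: (rev _) => //= x t Ht.
move=> pt; apply/andP; split.
  by rewrite ler_pM2l //; have [] := Ht x (mem_head _ _).
apply: (sub_in_path (P := [in x :: t])) pt; last by apply/allP.
move=> y z yt zt zy.
by apply: pow2_lt => //; [have [] := Ht z zt|have [] := Ht y yt].
Qed.

(* With [2 ^ L > size r], the values below [M / 2 ^ L], [M] the largest one,
   contribute at most [M]; the others take at most [L] distinct values. *)
Lemma sum_pow2_log (I : eqType) (r : seq I) (F : I -> R) (Q : R) :
  {in r, forall i, F i = 0 \/ pow2 (F i)} ->
  (forall a, 0 < a -> \sum_(i <- r | F i == a) a <= Q) -> 0 <= Q ->
  \sum_(i <- r) F i <= (trunc_log 2 (size r)).+2%:R * Q.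
Proof.
move=> Fr FQ Q0; set L := (trunc_log 2 (size r)).+1.
have [/hasP[i0 i0r Fi0]|/hasPn F0] := boolP (has (fun i => 0 < F i) r);
  last first.
  rewrite big_seq big1 ?mulr_ge0 // => i ir.
  by have [//|/pow2_gt0] := Fr _ ir; rewrite (negbTE (F0 _ ir)).
have [im imr immax] : exists2 m, m \in r & {in r, forall i, F i <= F m}.
  have : r != [::] by case: (r) i0r.
  move: (r) => [//|x s] _; elim: s x => [|y s IH] x.
    by exists x; rewrite ?mem_head // => i; rewrite inE => /eqP->.
  have [m ms mm] := IH y; have [xm|mx] := leP (F x) (F m).
    exists m => [|i]; first by rewrite inE ms orbT.
    by rewrite inE => /orP[/eqP->//|/mm].
  exists x => [|i]; first exact: mem_head.
  by rewrite inE => /orP[/eqP->//|/mm/le_trans]; apply; exact: ltW.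
set M := F im in immax.
have M0 : 0 < M by exact: lt_le_trans (immax _ i0r).
have pM : pow2 M by have [E|//] := Fr _ imr; rewrite /M E ltxx in M0.
have MQ : M <= Q.
  apply: le_trans (FQ M M0); rewrite (big_rem im) //= /M eqxx lerDl.
  by apply: sumr_ge0 => i _; exact: ltW.
have p2 n : (0 : R) < 2 ^+ n by exact: exprn_gt0.
have key i : i \in r -> F i <= M / 2 ^+ L +
    \sum_(0 <= l < L | F i == M / 2 ^+ l) M / 2 ^+ l.
  move=> ir; have S0 (P : pred nat) : 0 <= \sum_(0 <= l < L | P l) M / 2 ^+ l.
    by apply: sumr_ge0 => l _; apply: divr_ge0; exact: ltW.
  have [Fi|Fi] := leP (F i) (M / 2 ^+ L).
    by apply: le_trans Fi _; rewrite lerDl.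
  have pF : pow2 (F i).
    by have [E|//] := Fr _ ir; move: Fi; rewrite E ltNge divr_ge0 // ltW.
  suff [l lL El] : exists2 l, (l < L)%N & F i = M / 2 ^+ l.
    rewrite (big_rem l) ?mem_index_iota //= El eqxx addrCA lerDl.
    by apply: addr_ge0; last apply: sumr_ge0 => ? _; rewrite divr_ge0 ?ltW.
  have : F i <= M by exact: immax.
  move: Fi; elim: {S0} L => [|K IH].
    by rewrite expr0 divr1 ltNge => /negbTE ->.
  have [FK|FK] := ltP (M / 2 ^+ K) (F i).
    by move=> _ FM; have [l lK El] := IH FK FM; exists l => //; exact: ltnW.
  move=> FS FM; exists K => //; apply/eqP; rewrite eq_le FK /=.
  have := pow2_lt (pow2_half K.+1 pM) pF FS.
  by rewrite exprS invfM mulrCA mulVKf ?pnatr_eq0.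
rewrite big_seq; apply: le_trans (ler_sum _ key) _; rewrite -big_seq.
rewrite big_split /=.
rewrite (exchange_big_dep xpredT) //= -[L.+1%:R]natr1 mulrDl mul1r [leRHS]addrC.
apply: lerD.
  apply: le_trans MQ; rewrite big_const_seq count_predT iter_addr_0.
  rewrite -[leLHS]mulr_natr mulrAC ler_pdivrMr // ler_pM2l // -natrX ler_nat.
  by rewrite ltnW // trunc_log_ltn.
apply: (le_trans (y := \sum_(0 <= l < L) Q)).
  apply: ler_sum => l _; have := FQ (M / 2 ^+ l); apply.
  exact: divr_gt0.
by rewrite sumr_const_nat subn0 mulr_natl.
Qed.
End PowersOfTwo.

(** * Nets *)

Record node (R : realType) := Node { opened : bool; parent : nat; reach : R }.

Lemma count_le1 (T : eqType) (s : seq T) (P : pred T) : uniq s ->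
  {in s &, forall u v, P u -> P v -> u = v} -> (count P s <= 1)%N.
Proof.
move=> us Ps; rewrite -size_filter.
have : uniq [seq v <- s | P v] by rewrite filter_uniq.
have : {in [seq v <- s | P v], forall v, v \in s /\ P v}.
  by move=> v; rewrite mem_filter => /andP[].
case: [seq v <- _ | P v] => [//|u [//|v t]] Puv /= /andP[].
have [us' Pu] := Puv u (mem_head _ _).
have [|vs Pv] := Puv v; first by rewrite !inE eqxx orbT.
by rewrite (Ps u v) // mem_head.
Qed.

Section Net.
Context {R : realType}.
Implicit Types (d : nat -> nat -> R) (op : nat -> bool) (h : nat -> node R).

(** The root has scale 0 and hence needs a clause of its own: it accepts at any distance. *)
Definition willing h (row : nat -> R) (w : nat) : bool :=
  opened (h w) && ((w == 0%N) || (row w <= up2 (reach (h w)) / 4)).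

(** [n.+1] counts the arriving point too. A point at distance 0 from a point accepting it never
    opens. *)
Definition arrive op h (u : nat) (row : nat -> R) : node R :=
  let p : 'I_u.+1 := [arg min_(w < ord0 | willing h row w) row w]%O in
  let e := up2 (row p) in
  let n := count (fun c => (up2 (reach (h c)) == e) && (row c <= e / 16))
                 (iota 1 u) in
  Node ((0 < row p) && op n.+1) p (row p).

(* Masking the row makes it evident that a node depends on the distances to
   earlier points only. *)
Fixpoint hist op d (t : nat) : nat -> node R :=
  if t is u.+1 then
    let h := hist op d u in
    fun v => if v == u.+1
             then arrive op h u (fun w => if (w <= u)%N then d u.+1 w else 0)
             else h v
  else fun=> Node true 0 0.

Definition net op d (v : nat) : node R := hist op d v v.

Lemma hist_net op d t u : (u <= t)%N -> hist op d t u = net op d u.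
Proof.
elim: t => [|t IH]; first by rewrite leqn0 => /eqP->.
rewrite leq_eqVlt => /orP[/eqP->//|ut] /=.
by rewrite ltn_eqF // IH.
Qed.

(** Metrics that look alike after [t] arrivals. The [_local] lemmas, which show that the algorithm
    is online, compare runs on two such metrics. *)
Definition agree (t : nat) d d' :=
  forall x y, (x <= t)%N -> (y <= t)%N -> d x y = d' x y.

Lemma agreeW t u d d' : (u <= t)%N -> agree t d d' -> agree u d d'.
Proof. by move=> ut H x y xu yu; apply: H; apply: leq_trans ut. Qed.

Lemma hist_local op d d' t : agree t d d' -> hist op d t = hist op d' t.
Proof.
elim: t => //= t IH H; rewrite IH; last exact: agreeW H.
suff -> : (fun w => if (w <= t)%N then d t.+1 w else 0) =
          (fun w => if (w <= t)%N then d' t.+1 w else 0) by [].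
by apply/funext => w; case: leqP => // wt; apply: H => //; exact: leqW.
Qed.

Lemma net_local op d d' t v : agree t d d' -> (v <= t)%N ->
  net op d v = net op d' v.
Proof. by move=> H vt; rewrite /net (hist_local _ (agreeW vt H)). Qed.

Section Spec.
Variables (op : nat -> bool) (d : nat -> nat -> R).
Local Notation N := (net op d).
Local Notation H v := (opened (N v)).
Local Notation D v := (reach (N v)).
Local Notation E v := (up2 (reach (N v))).

Lemma net_spec u : let v := u.+1 in
  [/\ (parent (N v) <= u)%N, H (parent (N v)), D v = d v (parent (N v)),
      parent (N v) = 0%N \/ D v <= E (parent (N v)) / 4 &
      (forall w, (w <= u)%N -> H w -> w = 0%N \/ d v w <= E w / 4 ->
                 D v <= d v w)] /\
  H v = (0 < D v) &&
        op (count (fun c => (E c == E v) && (d v c <= E v / 16)) (iota 1 u)).+1.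
Proof.
move=> v; rewrite /N /= eqxx.
set row := fun w => if (w <= u)%N then d u.+1 w else 0.
have rowE (w : nat) : (w <= u)%N -> row w = d v w by rewrite /row => ->.
move: row rowE => row rowE; rewrite /arrive.
case: arg_minP; first by rewrite /willing eqxx (hist_net op d (leq0n u)).
move=> p /andP[Hp Wp] minp; have pu : (p <= u)%N by rewrite -ltnS.
rewrite hist_net // in Hp Wp; rewrite /=; split; last first.
  congr (_ && op _.+1); apply: eq_in_count => c.
  rewrite mem_iota add1n ltnS => /andP[_ cu].
  by rewrite (rowE c) // (rowE p) // hist_net.
split => //; first exact: rowE.
  by case/orP: Wp => [/eqP|]; [left|right].
move=> w wu Hw Ww; have := minp (Ordinal (wu : (w < u.+1)%N)).
rewrite /= (rowE w) //; apply.
rewrite /willing hist_net // Hw /= rowE //.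
by case: Ww => [->//|->]; rewrite orbT.
Qed.

Hypotheses (d0 : forall x, d x x = 0) (d_ge0 : forall x y, 0 <= d x y)
  (dC : forall x y, d x y = d y x)
  (dT : forall x y z, d x z <= d x y + d y z).

Lemma parent_lt v : (0 < v)%N -> (parent (N v) < v)%N.
Proof. by case: v => // u _; have [[]] := net_spec u. Qed.

Lemma opened_parent v : H (parent (N v)).
Proof. by case: v => // u; have [[]] := net_spec u. Qed.

Lemma reachE v : D v = d v (parent (N v)).
Proof. by case: v => [|u]; [rewrite d0|have [[]] := net_spec u]. Qed.

Lemma reach_le v w : (w < v)%N -> H w -> w = 0%N \/ d v w <= E w / 4 ->
  D v <= d v w.
Proof.
by case: v => // u wu; have [[_ _ _ _ min_v] _] := net_spec u; exact: min_v.
Qed.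

Lemma reach_root v : D v <= d v 0%N.
Proof.
by case: v => [|v]; [rewrite d0|apply: reach_le => //; left].
Qed.

Lemma scale_parent v : parent (N v) = 0%N \/ D v <= E (parent (N v)) / 4.
Proof. by case: v => [|u]; [left|have [[]] := net_spec u]. Qed.

Definition near_class v c := (E c == E v) && (d v c <= E v / 16).

Lemma openedE v : (0 < v)%N ->
  H v = (0 < D v) && op (count (near_class v) (iota 1 v)).
Proof.
case: v => // u _; have [_ ->] := net_spec u.
have -> : iota 1 u.+1 = iota 1 u ++ [:: u.+1].
  by rewrite -(addn1 u) iotaD add1n addn1.
rewrite count_cat /= /near_class eqxx d0.
by rewrite divr_ge0 ?up2_ge0 // addn0 addn1.
Qed.

Lemma opened_gt0 v : (0 < v)%N -> H v -> 0 < E v.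
Proof. by move=> v0; rewrite openedE // => /andP[]; rewrite up2_gt0. Qed.

(** If [d u v <= E v / 8], then [u] would accept [v], so the reach of [v] would be at most [E v / 8]
    and its scale below [E v / 4]. *)
Lemma opened_sep u v : (0 < u < v)%N -> H u -> E u = E v -> E v / 8 < d u v.
Proof.
case/andP=> u0 uv Hu Euv; have E0 := opened_gt0 u0 Hu.
rewrite ltNge; apply/negP => duv.
have Dv : 0 < D v by rewrite -up2_gt0 -Euv.
have Dle : D v <= d v u by apply: reach_le => //; right; rewrite dC; lra.
by have := up2_lt Dv; rewrite dC in Dle; lra.
Qed.

Lemma opened_close u v : (0 < u)%N -> (0 < v)%N -> H u -> H v -> E u = E v ->
  d u v <= E v / 8 -> u = v.
Proof.
move=> u0 v0 Hu Hv Euv dist; case: (ltngtP u v) => // lt_uv.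
  have := @opened_sep u v; rewrite u0 lt_uv => /(_ isT Hu Euv).
  by rewrite ltNge dist.
have := @opened_sep v u; rewrite v0 lt_uv => /(_ isT Hv (esym Euv)).
by rewrite ltNge dC Euv dist.
Qed.

(* A point lies within [E / 16] of at most one open point of its own class. *)
Lemma credit (k : nat) (s b : R) : 0 <= b ->
  (forall n, op n -> s <= b * n%:R) ->
  s * \sum_(1 <= v < k.+1 | H v) E v <= b * \sum_(1 <= c < k.+1) E c.
Proof.
move=> b0 sb; rewrite !mulr_sumr.
(* Each open [v] charges the points of its class within [E v / 16]; those present at its opening
   already pay for [s]. After exchanging the sums, each [c] is charged at most once. *)
apply: (@le_trans _ _ (\sum_(1 <= v < k.+1 | H v)
                         \sum_(1 <= c < k.+1 | near_class v c) b * E c)).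
  rewrite big_nat_cond [leRHS]big_nat_cond.
  apply: ler_sum => v /andP[/andP[v0 vk] Hv].
  have := Hv; rewrite openedE // => /andP[Dv /sb {}sb].
  rewrite (eq_bigr (fun=> b * E v)); last by move=> c /andP[/eqP-> _].
  rewrite big_const_seq iter_addr_0 -[leRHS]mulr_natr mulrAC.
  rewrite ler_wpM2r ?up2_ge0 //; apply: le_trans sb _.
  rewrite ler_wpM2l // ler_nat /index_iota subSS subn0.
  rewrite -(subnKC (_ : v <= k)%N) //.
  by rewrite iotaD count_cat leq_addr.
rewrite (exchange_big_dep xpredT) //=; apply: ler_sum => c _.
rewrite big_const_seq iter_addr_0 -[leRHS]mulr1 -[leLHS]mulr_natr.
rewrite ler_wpM2l ?mulr_ge0 ?up2_ge0 // -[1]/(1%:R) ler_nat.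
apply: count_le1 (iota_uniq _ _) _ => u v.
rewrite !mem_index_iota => /andP[u0 _] /andP[v0 _].
case/andP=> Hu /andP[/eqP cu du] /andP[Hv /andP[/eqP cv dv]].
apply: opened_close => //; first by rewrite -cu -cv.
by have := dT u c v; rewrite (dC c v); rewrite -cv -cu in dv du *; lra.
Qed.

(** Within [Y], at most one point of scale [e] is open, by separation. When the last closed one
    arrived, all the other closed ones were near it, and yet [op] failed; so the closed ones
    contribute at most [s], and the open one at most [b <= s]. *)
Lemma packing (k : nat) (s b e : R) (Y : pred nat) : 0 <= b -> b <= s ->
  (forall n, (n <= k)%N -> ~~ op n -> b * n%:R <= s) -> 0 < e ->
  {in Y &, forall u v, d u v <= e / 16} ->
  b * (count (fun c => (E c == e) && Y c) (iota 1 k))%:R <= 2 * s.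
Proof.
move=> b0 bs bop e0 Yd; set P := fun c => _.
have -> : count P (iota 1 k) = (count (fun c => P c && H c) (iota 1 k)
                              + count (fun c => P c && ~~ H c) (iota 1 k))%N.
  by elim: (iota _ _) => //= c l ->; case: (P c); case: (H c) => /=; lia.
rewrite natrD mulrDr; have s0 := le_trans b0 bs.
have le1 : (count (fun c => P c && H c) (iota 1 k) <= 1)%N.
  apply: count_le1 (iota_uniq _ _) _ => u v.
  rewrite !mem_iota => /andP[u0 _] /andP[v0 _].
  case/andP=> /andP[/eqP Eu Yu] Hu /andP[/andP[/eqP Ev Yv] Hv].
  apply: opened_close => //; rewrite ?Eu ?Ev //.
  by have := Yd u v Yu Yv; lra.
have sum1 : b * (count (fun c => P c && H c) (iota 1 k))%:R <= s.
  by apply: le_trans bs; rewrite -[leRHS]mulr1 ler_wpM2l // -[1]/(1%:R) ler_nat.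
suff : b * (count (fun c => P c && ~~ H c) (iota 1 k))%:R <= s by lra.
set Q := fun c => P c && _.
have [/hasP[v1 v1k Qv1]|] := boolP (has Q (iota 1 k)); last first.
  by rewrite has_count -leqNgt leqn0 => /eqP->; rewrite mulr0.
have exQ : exists v, (v \in iota 1 k) && Q v by exists v1; rewrite v1k.
have bQ v : (v \in iota 1 k) && Q v -> (v <= k)%N by rewrite mem_iota; lia.
have [v /andP[vk Qv] maxv] := ex_maxnP exQ bQ.
have v0 : (0 < v)%N by move: vk; rewrite mem_iota => /andP[].
have vlek := bQ v; rewrite vk Qv in vlek; have {}vlek := vlek isT.
have /andP[/andP[/eqP Ev Yv] nHv] := Qv.
have Dv : 0 < D v by rewrite -up2_gt0 Ev.
have nop : ~~ op (count (near_class v) (iota 1 v)).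
  by move: nHv; rewrite openedE // Dv.
apply: le_trans (bop _ _ nop); last first.
  by apply: leq_trans (count_size _ _) _; rewrite size_iota.
rewrite ler_wpM2l // ler_nat -(subnKC vlek) iotaD count_cat.
rewrite [X in (_ + X)%N](_ : _ = 0)%N ?addn0; last first.
  apply/eqP; rewrite -leqn0 leqNgt -has_count; apply/hasPn => w.
  rewrite mem_iota -addnA subnKC // => /andP[vw wk]; apply/negP => Qw.
  have : (w <= v)%N by apply: maxv; rewrite Qw mem_iota wk (leq_trans _ vw).
  by rewrite leqNgt -add1n vw.
apply: sub_count => c /andP[/andP[/eqP Ec Yc] _].
by rewrite /near_class Ec Ev eqxx Yd.
Qed.

End Spec.
End Net.

(** * Routing in the nets *)

Fixpoint chain (T : eqType) (x : T) (st : seq (T * T)) : bool :=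
  if st is (a, b) :: st' then (a == x) && chain b st' else true.

Definition chain_end (T : eqType) (x : T) (st : seq (T * T)) : T :=
  last x [seq s.2 | s <- st].

Lemma chain_cat (T : eqType) (x : T) (s1 s2 : seq (T * T)) :
  chain x (s1 ++ s2) = chain x s1 && chain (chain_end x s1) s2.
Proof. by elim: s1 x => [|[a b] s IH] x //=; rewrite IH andbA. Qed.

Lemma chain_end_cat (T : eqType) (x : T) (s1 s2 : seq (T * T)) :
  chain_end x (s1 ++ s2) = chain_end (chain_end x s1) s2.
Proof. by rewrite /chain_end map_cat last_cat. Qed.

Lemma chain_path (T : eqType) (x : T) (st : seq (T * T)) : chain x st ->
  path (fun a b => (a, b) \in st) x [seq s.2 | s <- st].
Proof.
elim: st x => //= -[a b] st IH x /andP[/eqP-> /IH p] /=.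
rewrite mem_head /=; apply: sub_path p => u v uv.
by rewrite inE uv orbT.
Qed.

Section Climb.
Context {R : realType}.
Implicit Types (d : nat -> nat -> R) (op : nat -> bool).

Definition nearest (op' : nat -> bool) d (t y : nat) : nat :=
  ([arg min_(z < ord0 : 'I_t.+1 | opened (net op' d z)) d y z]%O : 'I_t.+1).

Definition gap (op' : nat -> bool) d t y : R := d y (nearest op' d t y).

(** The first suitable point rather than the nearest: the choice then depends on [t] only through
    the rounded gap, which limits the number of edges bought. *)
Definition target (op' : nat -> bool) d t y : nat :=
  find (fun z => opened (net op' d z) && (d y z <= up2 (gap op' d t y)))
       (iota 0 t.+1).

Definition direct op (op' : nat -> bool) d t y : bool :=
  gap op' d t y <= 8 * up2 (reach (net op d y)).

(** Parents have smaller indices and the root is always [direct], so fuel [y] suffices. *)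
Fixpoint climb op (op' : nat -> bool) d t (fuel y : nat) : seq (nat * nat) :=
  if direct op op' d t y then [:: (y, target op' d t y)]
  else (y, parent (net op d y)) ::
       if fuel is f.+1 then climb op op' d t f (parent (net op d y)) else [::].

Lemma parent_le op d v : (parent (net op d v) <= v)%N.
Proof. by case: v => // v; apply/ltnW/parent_lt. Qed.

Section Local.
Variables (d d' : nat -> nat -> R) (t : nat).
Hypothesis dd' : agree t d d'.

Lemma nearest_local op' y : (y <= t)%N ->
  nearest op' d t y = nearest op' d' t y.
Proof.
move=> yt; rewrite /nearest.
have -> : (fun z : 'I_t.+1 => opened (net op' d z)) =
          (fun z : 'I_t.+1 => opened (net op' d' z)).
  by apply/funext => z; rewrite (net_local _ dd') // -ltnS.
suff -> : (fun z : 'I_t.+1 => d y z) = (fun z : 'I_t.+1 => d' y z) by [].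
by apply/funext => z; apply: dd' => //; rewrite -ltnS.
Qed.

Lemma nearest_le op' y : (nearest op' d t y <= t)%N.
Proof. by rewrite -ltnS; exact: ltn_ord. Qed.

Lemma gap_local op' y : (y <= t)%N -> gap op' d t y = gap op' d' t y.
Proof.
move=> yt; rewrite /gap -nearest_local //; apply: dd' => //.
exact: nearest_le.
Qed.

Lemma target_local op' y : (y <= t)%N -> target op' d t y = target op' d' t y.
Proof.
move=> yt; rewrite /target gap_local //; apply: eq_in_find => z.
by rewrite mem_iota ltnS => /= zt; rewrite (net_local _ dd') // dd'.
Qed.

Lemma climb_local op op' f y : (y <= t)%N ->
  climb op op' d t f y = climb op op' d' t f y.
Proof.
elim: f y => [|f IH] y yt /=;
  rewrite /direct gap_local // target_local // (net_local _ dd') //.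
by rewrite IH // (leq_trans _ yt) // parent_le.
Qed.

End Local.

Section Spec.
Variables (d : nat -> nat -> R).
Hypotheses (d0 : forall x, d x x = 0) (d_ge0 : forall x y, 0 <= d x y)
  (dC : forall x y, d x y = d y x)
  (dT : forall x y z, d x z <= d x y + d y z).
Variables (op op' : nat -> bool) (t : nat).
Local Notation gap := (gap op' d t).
Local Notation target := (target op' d t).
Local Notation direct := (direct op op' d t).
Local Notation climb := (climb op op' d t).
Local Notation H' v := (opened (net op' d v)).
Local Notation H v := (opened (net op d v)).
Local Notation E v := (up2 (reach (net op d v))).

Lemma nearestP y : H' (nearest op' d t y) /\
  forall z, (z <= t)%N -> H' z -> gap y <= d y z.
Proof.
rewrite /gap /nearest; case: arg_minP => //= z Hz zmin; split=> // w wt Hw.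
exact: (zmin (Ordinal (wt : (w < t.+1)%N))).
Qed.

Lemma gap_le y z : (z <= t)%N -> H' z -> gap y <= d y z.
Proof. by have [_] := nearestP y; apply. Qed.

Lemma gap_ge0 y : 0 <= gap y.
Proof. exact: d_ge0. Qed.

Lemma gap_lip x y : gap y <= d y x + gap x.
Proof.
apply: le_trans (dT y x (nearest op' d t x)).
by apply: gap_le; [exact: nearest_le|have [] := nearestP x].
Qed.

Lemma gap0 : gap 0 = 0.
Proof. by apply: le_anti; rewrite gap_ge0 andbT -[leRHS](d0 0%N) gap_le. Qed.

Lemma target_has y :
  has (fun z => H' z && (d y z <= up2 (gap y))) (iota 0 t.+1).
Proof.
apply/hasP; exists (nearest op' d t y).
  by rewrite mem_iota ltnS nearest_le.
by have [-> _] := nearestP y; rewrite up2_ge.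
Qed.

Lemma target_le y : (target y <= t)%N.
Proof. by rewrite -ltnS -[ltnRHS](size_iota 0) -has_find target_has. Qed.

Lemma targetP y : H' (target y) /\ d y (target y) <= up2 (gap y).
Proof.
have := nth_find 0%N (target_has y).
by rewrite nth_iota ?add0n => [/andP[]|]; rewrite // ltnS; exact: target_le.
Qed.

Lemma dist_target y : d y (target y) <= 2 * gap y.
Proof.
have [_ /le_trans] := targetP y; apply.
have := gap_ge0 y; rewrite le_eqVlt => /predU1P[<-|g0].
  by rewrite up2_npos // mulr0.
by apply: ltW; exact: up2_lt.
Qed.

Lemma direct0 : direct 0.
Proof. by rewrite /direct gap0 mulr_ge0 ?up2_ge0. Qed.

Definition climb_step (s : nat * nat) : Prop :=
  [/\ H s.1, (s.1 <= t)%N &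
      direct s.1 /\ s.2 = target s.1 \/
      (0 < s.1)%N /\ s.2 = parent (net op d s.1)].

(** The slack [- 4 * E y] carries the induction. A parent step costs at most [E y] and raises the
    gap by no more than its length. If the parent is direct, [8 * E y < gap y] absorbs this;
    otherwise the slack of the parent does, its scale being at least 4 times the length of the
    step. *)
Lemma climbP f y : (y <= f)%N -> (y <= t)%N -> H y ->
  let st := climb f y in
  [/\ chain y st, H' (chain_end y st), (chain_end y st <= t)%N,
      {in st, forall s, climb_step s} &
      \sum_(s <- st) d s.1 s.2 <=
        if direct y then 2 * gap y else 3 * gap y - 4 * E y].
Proof.
elim: f y => [|f IH] y yf yt Hy /=.
  move: yf; rewrite leqn0 => /eqP y0; rewrite y0 direct0 /= /chain_end /=.
  have [H't _] := targetP 0; split=> //; first exact: target_le.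
    by move=> s; rewrite inE => /eqP->; split=> //; left; rewrite direct0.
  by rewrite big_seq1 dist_target.
case: ifPn => [dy|ndy] /=.
  have [H't _] := targetP y; rewrite eqxx; split=> //; first exact: target_le.
    by move=> s; rewrite inE => /eqP->; split=> //; left.
  by rewrite big_seq1 dist_target.
have y0 : (0 < y)%N by case: (y) ndy => //; rewrite direct0.
have py := parent_lt op d y0; set p := parent _ in py *.
have [//|//||ch He et Hst len] := IH p; [lia|lia|exact: opened_parent|].
rewrite eqxx /=; split=> //.
  by move=> s; rewrite inE => /orP[/eqP->|/Hst//]; split=> //; right.
rewrite big_cons /=.
have Dy : d y p <= E y by rewrite -reachE // up2_ge.
have Ey : E y < 2 * d y p.
  rewrite -reachE //; apply: up2_lt; move: Hy.
  by rewrite openedE // => /andP[].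
have gy : 8 * E y < gap y by rewrite ltNge.
have := gap_lip y p; rewrite dC => gp.
case: ifPn len => [_|ndp] len; first lra.
have [p0|Ep] := scale_parent op d y; first by rewrite /p p0 direct0 in ndp.
rewrite reachE // -/p in Ep; lra.
Qed.

Lemma climb_length f y : (y <= f)%N -> (y <= t)%N -> H y ->
  \sum_(s <- climb f y) d s.1 s.2 <= 3 * gap y.
Proof.
move=> yf yt Hy; have [_ _ _ _] := climbP yf yt Hy.
move=> /le_trans; apply; have := gap_ge0 y.
by have := up2_ge0 (reach (net op d y)); case: ifP; lra.
Qed.

Lemma chain_dist x st : chain x st ->
  d x (chain_end x st) <= \sum_(s <- st) d s.1 s.2.
Proof.
elim: st x => [|[a b] st IH] x /=; first by rewrite big_nil d0.
case/andP=> /eqP-> /IH len; rewrite big_cons /=.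
by apply: le_trans (dT x b _) _; rewrite lerD2l.
Qed.

End Spec.

(** The search succeeds among the first [t.+1] points, so a longer range does not change the hit. *)
Lemma target_stable (op' : nat -> bool) d t k y : (t <= k)%N ->
  target op' d t y =
  find (fun z => opened (net op' d z) && (d y z <= up2 (gap op' d t y)))
       (iota 0 k.+1).
Proof.
move=> tk; rewrite -(subnKC (_ : t.+1 <= k.+1)%N) //.
by rewrite iotaD find_cat target_has.
Qed.
End Climb.

(** * Ascending through all nets *)

Section Ascend.
Context {R : realType}.
Variable ops : nat -> nat -> bool.

Fixpoint ascend (d : nat -> nat -> R) t (r l x : nat) : seq (nat * nat * nat) :=
  if r is r'.+1 then
    let st := climb (ops l) (ops l.+1) d t x x in
    [seq (s, l) | s <- st] ++ ascend d t r' l.+1 (chain_end x st)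
  else [::].

Variable d : nat -> nat -> R.
Hypotheses (d0 : forall x, d x x = 0) (d_ge0 : forall x y, 0 <= d x y)
  (dC : forall x y, d x y = d y x)
  (dT : forall x y z, d x z <= d x y + d y z).

Lemma ascend_local d' t r l x : agree t d d' -> (x <= t)%N ->
  opened (net (ops l) d x) ->
  ascend d t r l x = ascend d' t r l x.
Proof.
move=> dd'; elim: r l x => //= r IH l x xt Hx.
rewrite -(climb_local dd') //; congr (_ ++ _); apply: IH.
  by have [] := climbP d0 d_ge0 dC dT (ops l.+1) (leqnn x) xt Hx.
by have [] := climbP d0 d_ge0 dC dT (ops l.+1) (leqnn x) xt Hx.
Qed.

Lemma ascendP t r l x : (x <= t)%N -> opened (net (ops l) d x) ->
  let st := ascend d t r l x in
  let pts := [seq s.1 | s <- st] in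
  [/\ chain x pts, opened (net (ops (l + r)) d (chain_end x pts)),
      (chain_end x pts <= t)%N &
      {in st, forall s, (l <= s.2 < l + r)%N /\
        climb_step d (ops s.2) (ops s.2.+1) t s.1}].
Proof.
elim: r l x => [|r IH] l x xt Hx /=; first by rewrite addn0.
have [ch He et Hst _] := climbP d0 d_ge0 dC dT (ops l.+1) (leqnn x) xt Hx.
have [ch' He' et' Hst'] := IH l.+1 _ et He.
rewrite map_cat -map_comp map_id chain_cat chain_end_cat ch ch'.
rewrite addnS -addSn; split=> // s; rewrite mem_cat.
case/orP=> [/mapP[s' /Hst cs ->]|/Hst'[sl cs]].
  by split=> //=; rewrite leqnn addSn ltnS leq_addr.
by split=> //; lia.
Qed.

(* Walking to the end of layer [l] multiplies the distance to [v] by at most 4;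
   this is absorbed by [beta] dropping by a factor 8. *)
Lemma ascend_rent (beta : nat -> R) t r l v x : (v <= t)%N ->
  (forall i, 0 <= beta i) -> (forall i, 8 * beta i.+1 <= beta i) ->
  (x <= t)%N -> opened (net (ops l) d x) ->
  \sum_(s <- ascend d t r l x) beta s.2 * d s.1.1 s.1.2 <=
  6 * \sum_(l <= i < l + r) beta i * gap (ops i.+1) d t v + 6 * beta l * d v x.
Proof.
move=> vt b0 b8; elim: r l x => [|r IH] l x xt Hx /=.
  rewrite big_nil addn0 big_geq // mulr0 add0r mulr_ge0 // mulr_ge0 //.
have [ch He et _ _] := climbP d0 d_ge0 dC dT (ops l.+1) (leqnn x) xt Hx.
have len := climb_length d0 d_ge0 dC dT (ops l.+1) (leqnn x) xt Hx.
have := IH l.+1 _ et He; set x' := chain_end _ _ => {}IH.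
rewrite big_cat big_map /= -mulr_sumr addnS big_ltn ?ltnS ?leq_addr //.
set S := \sum_(_ <- climb _ _ _ _ _ _) _ in len *.
set g := gap _ _ _ x in len.
have gv := gap_lip dT (ops l.+1) t v x; rewrite dC in gv.
have dx' : d x x' <= S by exact: chain_dist.
have dvx' := dT v x x'.
have bl := b0 l; have bl1 := b0 l.+1; have bl8 := b8 l.
have dvx := d_ge0 v x.
rewrite addSn in IH; apply: le_trans (lerD (lexx _) IH) _.
set G := gap _ _ _ v in gv *; rewrite -/g in gv.
have G0 : 0 <= G by exact: gap_ge0.
have S3 : S <= 3 * (G + d v x) by lra.
(* Per unit of [beta l]: the climb costs [3 * (G + d v x)], and the term left for [x'] is at most
   [6 / 8 * (4 * d v x + 3 * G)]. Together this is [6 * d v x + 5.25 * G]. *)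
have h1 : beta l * S <= beta l * (3 * (G + d v x)) by rewrite ler_wpM2l.
have h2 : beta l.+1 * d v x' <= beta l.+1 * (d v x + 3 * (G + d v x)).
  by rewrite ler_wpM2l //; lra.
have h3 : 8 * beta l.+1 * (4 * d v x + 3 * G) <= beta l * (4 * d v x + 3 * G).
  by rewrite ler_wpM2r //; lra.
have h4 : 0 <= beta l * G by exact: mulr_ge0.
by lra.
Qed.

End Ascend.

(** The charging scheme used for both kinds of cost: [rel] assigns to each [a] of positive weight a
    [w] of at least that weight, and no [w] is used twice. *)
Lemma sum_cover (R : realType) (A B : eqType) (s : seq A) (W : seq B)
    (rel : A -> B -> bool) (F : A -> R) (G : B -> R) :
  uniq s -> {in W, forall w, 0 <= G w} ->
  {in W, forall w, {in s &, forall a a', rel a w -> rel a' w -> a = a'}} ->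
  {in s, forall a, F a <= 0 \/ exists2 w, w \in W & rel a w /\ F a <= G w} ->
  \sum_(a <- s) F a <= \sum_(w <- W) G w.
Proof.
move=> us G0 inj cov.
apply: (@le_trans _ _ (\sum_(a <- s) \sum_(w <- W | rel a w) G w)).
  rewrite big_seq [leRHS]big_seq; apply: ler_sum => a as_.
  have S0 (W' : seq B) : {subset W' <= W} -> 0 <= \sum_(w <- W' | rel a w) G w.
    by move=> W'W; rewrite big_seq_cond; apply: sumr_ge0 => w /andP[/W'W/G0].
  have [/le_trans->//|[w wW [aw]]] := cov a as_; first exact: S0.
  move=> /le_trans; apply; rewrite (big_rem w wW) aw lerDl.
  by apply: S0 => w'; exact: mem_rem.
rewrite (exchange_big_dep xpredT) //= big_seq [leRHS]big_seq.
apply: ler_sum => w wW; rewrite big_const_seq iter_addr_0.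
rewrite -[leLHS]mulr_natr -[leRHS]mulr1 ler_wpM2l ?G0 // -[1]/(1%:R) ler_nat.
apply: count_le1 => //; exact: inj.
Qed.

(** * Total length of the edges bought in one layer *)

Section LayerSteps.
Context {R : realType}.
Variables (d : nat -> nat -> R).
Hypotheses (d0 : forall x, d x x = 0) (d_ge0 : forall x y, 0 <= d x y)
  (dC : forall x y, d x y = d y x)
  (dT : forall x y z, d x z <= d x y + d y z).
Variables (op op' : nat -> bool) (k : nat).
Local Notation H v := (opened (net op d v)).
Local Notation E v := (up2 (reach (net op d v))).

(* As [y] jumps to the first suitable point, the direct edges of [y] are
   determined by the rounded gaps. *)
Definition classes y : seq R :=
  undup [seq up2 (gap op' d t y) | t <- iota 1 k & direct op op' d t y].

(** Contains every step of positive length that any of the first [k] terminals takes in this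
    layer. *)
Definition layer_steps : seq (nat * nat) :=
  [seq (y, parent (net op d y)) | y <- iota 1 k & H y] ++
  [seq (y, find (fun z => opened (net op' d z) && (d y z <= e)) (iota 0 k.+1))
  | y <- [seq y <- iota 1 k | H y], e <- classes y].

Lemma layer_stepsP t s : (0 < t <= k)%N -> climb_step d op op' t s ->
  d s.1 s.2 = 0 \/ s \in layer_steps.
Proof.
case: s => a b /andP[t0 tk] [/= Ha at_ st].
have [a0|a_gt0] := posnP a.
  left; case: st => [[_ ->]|[]]; last by rewrite a0.
  rewrite a0; apply: le_anti; rewrite d_ge0 andbT.
  by have := dist_target d_ge0 op' t 0; rewrite gap0 // mulr0.
have ak : a \in [seq y <- iota 1 k | H y].
  by rewrite mem_filter Ha mem_iota a_gt0; lia.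
right; rewrite mem_cat; apply/orP; case: st => [[dir ->]|[_ ->]].
  right; apply/allpairsPdep; exists a, (up2 (gap op' d t a)); split=> //.
    rewrite mem_undup; apply/mapP; exists t => //.
    by rewrite mem_filter dir mem_iota t0; lia.
  by rewrite -target_stable.
by left; apply/mapP; exists a.
Qed.

(** The nonzero rounded gaps at direct jumps are distinct powers of two, at most [8 * E y]. *)
Lemma classes_sum y : (0 < y)%N -> H y -> \sum_(e <- classes y) e <= 16 * E y.
Proof.
move=> y0 Hy; have E0 := opened_gt0 d0 y0 Hy.
have pE : pow2 (8 * E y).
  rewrite (_ : 8 = 2 ^+ 3); last by rewrite -natrX.
  by apply: pow2M; apply: up2P; rewrite -up2_gt0.
rewrite (bigID (fun e => 0 < e)) /= [X in _ + X]big1_seq ?addr0; last first.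
  move=> e /andP[ne]; rewrite mem_undup => /mapP[t _ et]; move: ne.
  by rewrite et lt_neqAle up2_ge0 andbT negbK => /eqP.
rewrite -big_filter (_ : 16 = 2 * 8); last by rewrite -natrM.
rewrite -mulrA; apply: sum_uniq_pow2.
- by rewrite filter_uniq ?undup_uniq.
- by rewrite mulr_ge0 // ltW.
move=> e; rewrite mem_filter mem_undup => /andP[e0 /mapP[t]].
rewrite mem_filter => /andP[dir _] et; split; last by rewrite et up2_le.
by rewrite et; apply: up2P; rewrite -up2_gt0 -et.
Qed.

(** 17 is 1 for the parent edge plus 16 for the direct edges. *)
Lemma layer_steps_length :
  \sum_(s <- layer_steps) d s.1 s.2 <= 17 * \sum_(1 <= y < k.+1 | H y) E y.
Proof.
rewrite big_cat /= big_map big_allpairs_dep /= -big_split /= big_filter.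
rewrite /index_iota subSS subn0 mulr_sumr big_seq_cond [leRHS]big_seq_cond.
apply: ler_sum => y /andP[]; rewrite mem_iota => /andP[y0 yk] Hy.
have := classes_sum y0 Hy.
have : d y (parent (net op d y)) <= E y by rewrite -reachE // up2_ge.
suff : \sum_(e <- classes y)
   d y (find (fun z => opened (net op' d z) && (d y z <= e)) (iota 0 k.+1)) <=
   \sum_(e <- classes y) e by lra.
rewrite big_seq [leRHS]big_seq; apply: ler_sum => e.
rewrite mem_undup => /mapP[t]; rewrite mem_filter => /andP[_].
rewrite mem_iota => /andP[t0 tk] ->; rewrite -target_stable; last by lia.
by have [] := targetP d op' t y.
Qed.

End LayerSteps.

(** * The decision for a single terminal *)

Section Decide.
Context {R : realType}.
Implicit Type d : nat -> nat -> R.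

(* Coinciding points are represented by the first of them, which makes it
   possible to turn a walk over indices into a simple path. *)
Definition rep d (x : nat) : nat := find (fun y => d x y == 0) (iota 0 x.+1).

Lemma rep_local d d' t x : agree t d d' -> (x <= t)%N -> rep d x = rep d' x.
Proof.
move=> dd' xt; apply: eq_in_find => y; rewrite mem_iota ltnS => /= yx.
by rewrite dd' // (leq_trans yx).
Qed.

Variables (ops : nat -> nat -> bool) (m M : nat) (tau : nat -> 'I_M).

(** A terminal coinciding with an open point may be closed in net 0, so the walk starts at its
    target there, which is at distance 0 by [start_dist]. *)
Definition steps d (t : nat) : seq (nat * nat * nat) :=
  ascend ops d t m 0 (target (ops 0%N) d t t).

(** Cables are bought along the whole walk; [shorten] removes its loops because routes must be
    simple. *)
Definition decide d (t : nat) : decision nat M :=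
  Decision [seq (s.1.1, s.1.2, tau s.2) | s <- steps d t]
           (shorten (rep d t) [seq rep d s.1.2 | s <- steps d t]).

Variable d : nat -> nat -> R.
Hypotheses (d0 : forall x, d x x = 0) (d_ge0 : forall x y, 0 <= d x y)
  (dC : forall x y, d x y = d y x)
  (dT : forall x y z, d x z <= d x y + d y z).

Lemma rep_le x : (rep d x <= x)%N.
Proof.
rewrite -ltnS -[ltnRHS](size_iota 0) -has_find; apply/hasP; exists x.
  by rewrite mem_iota ltnSn.
by rewrite d0.
Qed.

Lemma dist_rep x : d x (rep d x) = 0.
Proof.
have h : has (fun y => d x y == 0) (iota 0 x.+1).
  by apply/hasP; exists x; rewrite ?d0 // mem_iota ltnSn.
have := nth_find 0%N h; rewrite nth_iota ?add0n => [/eqP//|].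
by rewrite ltnS rep_le.
Qed.

Lemma dist0_trans x y z : d x y = 0 -> d y z = 0 -> d x z = 0.
Proof.
move=> xy yz; apply: le_anti; rewrite d_ge0 andbT.
by rewrite (le_trans (dT x y z)) // xy yz addr0.
Qed.

Lemma rep_eq x y : d x y = 0 -> rep d x = rep d y.
Proof.
have min u v : d u v = 0 -> (rep d u <= rep d v)%N.
  move=> uv; rewrite leqNgt; apply/negP => lt.
  have := @before_find _ 0%N (fun y => d u y == 0) (iota 0 u.+1) _ lt.
  rewrite nth_iota ?add0n; last first.
    by apply: leq_trans lt _; apply: leqW; exact: rep_le.
  by rewrite (dist0_trans uv (dist_rep v)) eqxx.
by move=> xy; apply/eqP; rewrite eqn_leq !min // dC.
Qed.

Lemma rep_inj x y : d (rep d x) (rep d y) = 0 -> rep d x = rep d y.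
Proof.
move=> xy; apply: rep_eq; apply: dist0_trans (dist_rep x) _.
by apply: dist0_trans xy _; rewrite dC dist_rep.
Qed.

Lemma rep0 : rep d 0 = 0%N.
Proof. by apply/eqP; rewrite -leqn0 rep_le. Qed.

Hypotheses (ops0 : forall n, (0 < n)%N -> ops 0 n)
  (opsm : forall n, ops m n = false).

Lemma start_dist t : d t (target (ops 0%N) d t t) = 0.
Proof.
suff g0 : gap (ops 0%N) d t t <= 0.
  apply: le_anti; rewrite d_ge0 andbT.
  by have := dist_target d_ge0 (ops 0%N) t t; lra.
case: (posnP t) => [->|t0]; first by rewrite gap0.
case Ht : (opened (net (ops 0%N) d t)); first by rewrite -(d0 t) gap_le.
apply: le_trans
  (gap_le t (parent_le (ops 0%N) d t) (opened_parent (ops 0%N) d t)) _.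
rewrite -reachE // leNgt; apply/negP => Dt; move: Ht; rewrite openedE // Dt.
rewrite ops0 // -has_count; apply/hasP; exists t.
  by rewrite mem_iota t0 add1n ltnSn.
by rewrite /near_class eqxx d0 divr_ge0 ?up2_ge0.
Qed.

Lemma stepsP t :
  let st := steps d t in
  let pts := [seq s.1 | s <- st] in
  let x := target (ops 0%N) d t t in
  [/\ chain x pts, chain_end x pts = 0%N &
      {in st, forall s, (s.2 < m)%N /\
        climb_step d (ops s.2) (ops s.2.+1) t s.1}].
Proof.
move=> st pts x.
have [Hx _] := targetP d (ops 0%N) t t.
have [ch He _ Hst] := ascendP d0 d_ge0 dC dT m (target_le _ _ _ _) Hx.
split=> //.
(* The walk ends at an open point of net [m], which can only be the root. *)
move: He; rewrite add0n -/x -/st -/pts.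
case: (posnP (chain_end x pts)) => // e0.
by rewrite openedE // opsm andbF.
Qed.

Lemma steps_le t s : s \in steps d t -> (s.1.1 <= t)%N && (s.1.2 <= t)%N.
Proof.
have [_ _ H] := stepsP t; move=> /H[_ [_ st1]].
rewrite st1 => -[[_ ->]|[_ ->]]; first exact: target_le.
exact: leq_trans (parent_le _ _ _) st1.
Qed.

Lemma steps_local d' t : agree t d d' -> steps d t = steps d' t.
Proof.
move=> dd'; rewrite /steps -(target_local dd') //.
apply: ascend_local => //; first exact: target_le.
by have [] := targetP d (ops 0%N) t t.
Qed.

Lemma decide_local d' t : agree t d d' -> decide d t = decide d' t.
Proof.
move=> dd'; rewrite /decide -(steps_local dd') -(rep_local dd') //.
congr (Decision _ (shorten _ _)); apply/eq_in_map => s /steps_le/andP[_ st].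
exact: rep_local dd' st.
Qed.

(** The last clause links each edge of the route to a step with a cable; loop removal preserves it,
    as it yields a path of the same relation. *)
Lemma routeP t (p := route (decide d t)) :
  [/\ uniq (rep d t :: p), last (rep d t) p = 0%N,
      {in p, forall x, rep d x = x /\ (x <= t)%N} &
      path (fun a b => has (fun s => (rep d s.1.1 == a) && (rep d s.1.2 == b))
                           (steps d t)) (rep d t) p].
Proof.
rewrite /p /=; pose e a b :=
  has (fun s => (rep d s.1.1 == a) && (rep d s.1.2 == b)) (steps d t).
rewrite -/e.
have [ch end0 _] := stepsP t.
have -> : rep d t = rep d (target (ops 0%N) d t t) by exact/rep_eq/start_dist.
set x := target _ _ _ _ in ch end0 *; set q := map _ _.
have qE : q = map (rep d) [seq s.2 | s <- [seq s.1 | s <- steps d t]].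
  by rewrite -!map_comp.
have pq : path e (rep d x) q.
  have := chain_path ch; rewrite qE => pq.
  rewrite path_map; apply: sub_path pq => a b /mapP[s sst E] /=.
  by apply/hasP; exists s; rewrite // -E !eqxx.
have lq : last (rep d x) q = 0%N.
  by rewrite qE last_map; move: end0; rewrite /chain_end => ->; exact: rep0.
rewrite -lq; case: (shortenP pq) => p' pp' up' sub; split=> // y /sub.
case/mapP=> s /steps_le/andP[_ st] ->; split.
  by apply: rep_eq; rewrite dC dist_rep.
exact: leq_trans (rep_le _) st.
Qed.

End Decide.

(** * Lower bounds on the cost of a solution *)

Lemma edgeP (V : choiceType) (u w : V) :
  edge u w = (u, w) \/ edge u w = (w, u).
Proof.
rewrite /edge; have /= := @chooseP _ (pred2 (u, w) (w, u)) (u, w).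
by rewrite eqxx => /(_ isT) /orP[] /eqP ->; [left|right].
Qed.

Lemma path_edges_mem (V : choiceType) (x : V) p e :
  e \in path_edges x p -> (e.1 \in x :: p) && (e.2 \in x :: p).
Proof.
elim: p x => //= y p IH x; rewrite inE => /orP[/eqP->|/IH].
  by have [->|->] := edgeP x y; rewrite /= !inE !eqxx !orbT.
by move=> /andP[e1 e2]; rewrite ![_ \in x :: _]inE e1 e2 !orbT.
Qed.

Lemma uniq_path_edges (V : choiceType) (x : V) p :
  uniq (x :: p) -> uniq (path_edges x p).
Proof.
elim: p x => //= y p IH x /andP[xp /IH->]; rewrite andbT.
apply: contra xp => /path_edges_mem.
by have [->|->] := edgeP x y => /= /andP[].
Qed.

Section LowerBound.
Context {R : realType} {V : metricType R}.

Definition near (q : R) (v : V) (e : V * V) : bool :=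
  (mdist v e.1 <= q) || (mdist v e.2 <= q).

(** By induction along the path until it leaves the ball; the edge that crosses the boundary counts
    in full. *)
Lemma near_path (q : R) (v x : V) (p : seq V) :
  mdist v x <= q -> q <= mdist v (last x p) ->
  q - mdist v x <= \sum_(e <- path_edges x p | near q v e) edge_length e.
Proof.
elim: p x => [|y p IH] x /= vx vr; first by rewrite big_nil; lra.
rewrite big_cons.
have -> : near q v (edge x y).
  by rewrite /near; have [->|->] := edgeP x y; rewrite /= vx ?orbT.
rewrite /= edge_lengthE; have := metric_triangle v x y.
have [vy|vy] := leP (mdist v y) q; first by have := IH y vy vr; lra.
have : 0 <= \sum_(e <- path_edges y p | near q v e) edge_length e.
  by apply: sumr_ge0 => e _; exact: mdist_ge0.
by lra.
Qed.

Variables (K : cable_types R) (r : V) (s : seq V)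
  (D : seq (decision V (ntypes K))).
Hypothesis solD : solution r s D.
Local Notation U :=
  (undup (flatten [seq route_edges r s D t | t <- iota 0 (size s)])).

Definition usage (e : V * V) : nat :=
  count (fun t => e \in route_edges r s D t) (iota 0 (size s)).

(* Each [t] in [S] pays for the edges of its route near its origin.  Users of
   [e] near their origin lie in one of two balls, so they number at most
   [4 * s0 / b]. *)
Lemma ball_lower_bound (S : pred nat) (q b s0 : R) : 0 <= q -> 0 <= b ->
  (forall t, S t -> (t < size s)%N -> q <= mdist (nth r s t) r) ->
  (forall x : V, b * (count (fun t => S t && (mdist (nth r s t) x <= q))
                            (iota 0 (size s)))%:R <= 2 * s0) ->
  b * q * (count S (iota 0 (size s)))%:R <=
  4 * \sum_(e <- U) edge_length e * Num.min s0 (b * (usage e)%:R).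
Proof.
move=> q0 b0 Sr Sx.
pose P t e := (e \in route_edges r s D t) && near q (nth r s t) e.
apply: (@le_trans _ _ (\sum_(t <- iota 0 (size s) | S t)
                         \sum_(e <- U | P t e) b * edge_length e)).
  rewrite mulr_natr -iter_addr_0 -big_const_seq.
  rewrite big_seq_cond [leRHS]big_seq_cond; apply: ler_sum => t.
  rewrite mem_iota => /andP[/= ts St]; have [_ /(_ t ts)[]] := solD.
  set v := nth r s t; set p := route _ => up lp _.
  rewrite -mulr_sumr ler_wpM2l //.
  have := @near_path q v v p; rewrite mdistxx subr0 lp; move=> /(_ q0).
  move=> /(_ (Sr t St ts)) /le_trans; apply.
  rewrite -big_filter -[leRHS]big_filter le_eqVlt; apply/orP; left; apply/eqP.
  apply: perm_big; apply: uniq_perm; rewrite ?filter_uniq ?undup_uniq //.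
    exact: uniq_path_edges.
  move=> e; rewrite !mem_filter mem_undup /P -/(route_edges _ _ _ t).
  rewrite -/v andbAC andbC; case ne: (near q v e); rewrite ?andbF //= !andbT.
  apply/idP/idP => [et|/andP[]//]; rewrite et.
  by apply/flattenP; exists (route_edges r s D t); rewrite // map_f // mem_iota.
rewrite (exchange_big_dep xpredT) //= mulr_sumr; apply: ler_sum => e _.
rewrite big_const_seq iter_addr_0 -[leLHS]mulr_natr mulrAC mulrCA.
rewrite [leLHS]mulrC ler_wpM2l ?mdist_ge0 //.
set n := count _ _.
have nU : (n <= usage e)%N by apply: sub_count => t /andP[_ /andP[]].
have n2 : b * n%:R <= 4 * s0.
  have := lerD (Sx e.1) (Sx e.2); rewrite -mulrDr -natrD => h.
  move: h; set c1 := count _ _; set c2 := count _ _ => h.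
  suff : b * n%:R <= b * (c1 + c2)%:R by lra.
  rewrite ler_wpM2l // ler_nat -count_predUI; apply: leq_trans (leq_addr _ _).
  by apply: sub_count => t /andP[St /andP[_]] /=; rewrite St.
rewrite minr_pMr // le_min n2 /=.
have : b * n%:R <= b * (usage e)%:R by rewrite ler_wpM2l // ler_nat.
have : 0 <= b * (usage e)%:R by rewrite mulr_ge0.
by lra.
Qed.

Lemma usage_load e : (usage e <= \sum_i load r s D e i)%N.
Proof.
rewrite /usage -sum1_count /load.
under [leqRHS]eq_bigr do rewrite -sum1_count.
rewrite (exchange_big_dep xpredT) //= big_mkcond /= big_seq [leqRHS]big_seq.
apply: leq_sum => t; rewrite mem_iota => /= ts; case: ifP => // et.
have [_ /(_ t ts)[_ _ /(_ e et)[i0 Hi0]]] := solD.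
have [i Hi imax] := arg_maxnP (fun j : 'I_(ntypes K) => j : nat) Hi0.
rewrite (bigD1 i) //= /highest_installed Hi /=.
by apply/forallP => j; apply/implyP => /imax.
Qed.

(** Subadditivity distributes [Phi] of the usage over the loads of the types, each of which is
    dominated by the price of its type. *)
Lemma cost_lower_bound (Phi : nat -> R) (C : R) : 0 <= C ->
  Phi 0%N = 0 -> {homo Phi : m n / (m <= n)%N >-> m <= n} ->
  (forall m n, Phi (m + n)%N <= Phi m + Phi n) ->
  (forall (q : 'I_(ntypes K)) n, (0 < n)%N ->
     Phi n <= C * (sigma q + beta q * n%:R)) ->
  \sum_(e <- U) edge_length e * Phi (usage e) <= C * cost r s D.
Proof.
move=> C0 Phi0 Phi_homo PhiD PhiC; rewrite /cost mulr_sumr.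
apply: ler_sum => e _; rewrite mulrCA ler_wpM2l ?mdist_ge0 //.
apply: le_trans (Phi_homo _ _ (usage_load e)) _.
apply: (@le_trans _ _ (\sum_i Phi (load r s D e i))).
  elim/big_ind2: _ => [|m1 n1 m2 n2 h1 h2|//]; first by rewrite Phi0.
  by apply: le_trans (PhiD _ _) _; exact: lerD.
rewrite (bigID (fun i => (0 < load r s D e i)%N)) /= [X in _ + X]big1 ?addr0.
  by rewrite mulr_sumr; apply: ler_sum => i; exact: PhiC.
by move=> i; rewrite lt0n negbK => /eqP->.
Qed.

Local Notation d := (fun x y => mdist (nth r (r :: s) x) (nth r (r :: s) y)).
Local Notation E op v := (up2 (reach (net op d v))).

(** [sum_pow2_log] reduces the sum to one scale at a time, where [ball_lower_bound] applies; 128 is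
    [32 * 4]. *)
Lemma layer_lower_bound (op : nat -> bool) (s0 b : R) : 0 <= b -> b <= s0 ->
  (forall n, (n <= size s)%N -> ~~ op n -> b * n%:R <= s0) ->
  b * \sum_(1 <= c < (size s).+1) E op c <=
  (trunc_log 2 (size s)).+2%:R *
  (128 * \sum_(e <- U) edge_length e * Num.min s0 (b * (usage e)%:R)).
Proof.
move=> b0 bs bop; set Q := 128 * _.
have Q0 : 0 <= Q.
  rewrite mulr_ge0 //; apply: sumr_ge0 => e _; rewrite mulr_ge0 ?mdist_ge0 //.
  by rewrite le_min mulr_ge0 // (le_trans b0).
move: b0; rewrite le_eqVlt => /predU1P[<-|b0]; first by rewrite mul0r mulr_ge0.
have bge0 := ltW b0.
rewrite -ler_pdivlMl // mulrCA mulrC -[X in trunc_log 2 X](size_iota 1).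
rewrite mulrC /index_iota subSS subn0.
apply: sum_pow2_log; last by rewrite mulr_ge0 // invr_ge0 ltW.
  move=> c _; have [Dc|Dc] := ltP 0 (reach (net op d c)).
    by right; exact: up2P.
  by left; exact: up2_npos.
have iota1 n : iota 1 n = [seq t.+1 | t <- iota 0 n] := iotaDl 1 0 n.
move=> a a0; rewrite big_const_seq iter_addr_0 ler_pdivlMl //.
rewrite -[a *+ _]mulr_natr iota1 count_map.
set S := fun t => E op t.+1 == a.
(* Balls of radius [a / 32] have the diameter [a / 16] that [packing] requires, and the root is
   farther away because the reach exceeds [a / 2]. *)
have h := @ball_lower_bound S (a / 32) b s0.
suff : b * (a / 32) * (count S (iota 0 (size s)))%:R <=
    4 * \sum_(e <- U) edge_length e * Num.min s0 (b * (usage e)%:R).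
  rewrite /Q; set T := \sum_(e <- _) _.
  rewrite -[count (preim _ _) _]/(count S (iota 0 (size s))).
  set N := (count _ _)%:R => hS.
  rewrite [leLHS](_ : _ = 32 * (b * (a / 32) * N)); first lra.
  by field.
apply: h => //.
- by rewrite divr_ge0 // ltW.
- move=> t /eqP Et ts.
  have Dt : 0 < reach (net op d t.+1) by rewrite -up2_gt0 Et.
  have := up2_lt Dt; rewrite Et.
  have := @reach_root _ op d (fun=> mdistxx _) (fun _ _ => mdist_ge0 _ _) t.+1.
  by lra.
move=> x.
have := @packing _ op d (fun=> mdistxx _) (fun _ _ => mdist_ge0 _ _)
  (fun _ _ => metric_sym _ _) (size s) s0 b a
  (fun c => mdist (nth r (r :: s) c) x <= a / 32) bge0 bs bop a0.
rewrite iota1 count_map; apply => u v; rewrite !unfold_in => ux vx.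
have := metric_triangle (nth r (r :: s) u) x (nth r (r :: s) v).
by rewrite (metric_sym x); lra.
Qed.
End LowerBound.

(** * Thinning the cable types *)

Section Thin.
Variables (T : eqType) (good : rel T).

Fixpoint thin (s : seq T) : seq T :=
  if s is x :: s' then
    let u := thin s' in
    if u is y :: _ then if good x y then x :: u else u else [:: x]
  else [::].

Lemma thin_subseq s : subseq (thin s) s.
Proof.
elim: s => //= x s; case: (thin s) => [_|y u IH]; first by rewrite eqxx sub0seq.
case: ifP => _; first by rewrite eqxx.
by apply: subseq_trans IH (subseq_cons _ _).
Qed.

Lemma thin_sorted s : sorted good (thin s).
Proof.
by elim: s => //= x s; case: (thin s) => // y u IH; case: ifP => //= ->.
Qed.

(** An element is dropped because of the head of the list kept so far, and that head is never
    removed later. *)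
Lemma thin_dominated (before : rel T) s x : pairwise before s -> x \in s ->
  x \in thin s \/ exists2 y, y \in thin s & ~~ good x y && before x y.
Proof.
elim: s => //= z s IH /andP[/allP zs /IH{}IH].
have sub := mem_subseq (thin_subseq s).
rewrite inE => /orP[/eqP->|/IH{IH}]; case: (thin s) sub => [|y u] sub //.
- by left; rewrite mem_head.
- case: ifPn => [_|ng]; first by left; rewrite mem_head.
  by right; exists y; rewrite ?mem_head // ng zs // sub ?mem_head.
- by case=> // -[].
case: ifP => _ // [xu|[w wu gw]]; first by left; rewrite inE xu orbT.
by right; exists w => //; rewrite inE wu orbT.
Qed.
End Thin.

Section Layers.
Context {R : realType} (K : cable_types R).
Local Notation M := (ntypes K).

Definition kept : seq 'I_M :=
  rev (thin (fun i j => 8 * beta i <= beta j)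
    (rev (thin (fun i j => 8 * sigma i <= sigma j) (enum 'I_M)))).

Lemma sigma_le (i j : 'I_M) : (i <= j)%N -> sigma i <= sigma j.
Proof.
rewrite leq_eqVlt => /orP[/eqP/val_inj->//|/sigma_incr/ltW//].
Qed.

Lemma beta_le (i j : 'I_M) : (i <= j)%N -> beta j <= beta i.
Proof.
rewrite leq_eqVlt => /orP[/eqP/val_inj->//|/beta_decr/ltW//].
Qed.

Lemma pairwise_enum : pairwise (fun i j : 'I_M => (i < j)%N) (enum 'I_M).
Proof.
have := iota_ltn_sorted 0 M.
rewrite -val_enum_ord sorted_pairwise; last exact: ltn_trans.
by rewrite pairwise_map.
Qed.

(** The first pass moves to a higher type, losing a factor 8 in [sigma] and nothing in [beta]; the
    second, on the reversed list, moves to a lower type with the roles exchanged. So the losses do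
    not multiply. *)
Lemma kept_dominates (q : 'I_M) :
  exists2 j, j \in kept & sigma j <= 8 * sigma q /\ beta j <= 8 * beta q.
Proof.
have sq := sigma_ge0 q; have bq := beta_ge0 q.
rewrite /kept; set g1 := fun i j : 'I_M => 8 * sigma i <= sigma j.
set L1 := thin g1 _.
have [q1 q1L [s1 b1]] : exists2 q1, q1 \in L1 &
    sigma q1 <= 8 * sigma q /\ beta q1 <= beta q.
  have [qL|[q1 q1L /andP[ng lt]]] :=
    thin_dominated g1 pairwise_enum (mem_enum 'I_M q).
    by exists q => //; split=> //; lra.
  exists q1 => //; split; last exact/beta_le/ltnW.
  by move: ng; rewrite /g1 -ltNge => /ltW.
have pL : pairwise (fun i j : 'I_M => (j < i)%N) (rev L1).
  rewrite -sorted_pairwise; last by move=> y x z xy yz; exact: ltn_trans yz xy.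
  rewrite rev_sorted sorted_pairwise; last by move=> y x z; exact: ltn_trans.
  exact: subseq_pairwise (thin_subseq _ _) pairwise_enum.
have b1' := beta_ge0 q1.
rewrite -mem_rev in q1L; have [qL|[q2 q2L /andP[ng lt]]] :=
    thin_dominated (fun i j : 'I_M => 8 * beta i <= beta j) pL q1L.
  by exists q1; [rewrite mem_rev|split=> //; lra].
exists q2; first by rewrite mem_rev.
have := sigma_le (ltnW lt); move: ng; rewrite -ltNge => ng.
by split; lra.
Qed.

Lemma kept_gt0 : (0 < size kept)%N.
Proof.
by have [j] := kept_dominates (Ordinal (ntypes_gt0 K)); case: kept.
Qed.

Definition layer (l : nat) : 'I_M := nth (Ordinal (ntypes_gt0 K)) kept l.

Local Notation m := (size kept).

Definition fixed (l : nat) : R := sigma (layer l).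
(** The value 0 past the last layer makes the geometric decay hold for all [l]. *)
Definition slope (l : nat) : R := if (l < m)%N then beta (layer l) else 0.

Lemma fixed_ge0 l : 0 <= fixed l. Proof. exact: sigma_ge0. Qed.

Lemma slope_ge0 l : 0 <= slope l.
Proof. by rewrite /slope; case: ifP => // _; exact: beta_ge0. Qed.

(** The second pass takes a subsequence, and [g1] is transitive. *)
Lemma fixed_geometric l : (l.+1 < m)%N -> 8 * fixed l <= fixed l.+1.
Proof.
move=> lm; set g1 := fun i j : 'I_M => 8 * sigma i <= sigma j.
suff /(sortedP (Ordinal (ntypes_gt0 K)))/(_ l lm) : sorted g1 kept by [].
have tr : transitive g1.
  by move=> y x z; rewrite /g1 => xy yz; have := sigma_ge0 y; lra.
have := thin_sorted g1 (enum 'I_M); rewrite !sorted_pairwise //.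
apply: subseq_pairwise; rewrite /kept -[X in subseq _ X]revK subseq_rev.
exact: thin_subseq.
Qed.

Lemma slope_geometric l : 8 * slope l.+1 <= slope l.
Proof.
rewrite /slope; case: ifP => lm; last by rewrite mulr0 slope_ge0.
rewrite ltnW //; suff /(sortedP (Ordinal (ntypes_gt0 K)))/(_ l lm) :
  sorted (fun i j : 'I_M => 8 * beta j <= beta i) kept by [].
rewrite /kept rev_sorted; exact: thin_sorted.
Qed.

(* [rate l] is the amount that a unit of demand pays per unit of its distance
   to net [l]: once [fixed l] is reached, net [l] is extended.  Net [m] consists
   of the root alone. *)
Definition rate (l : nat) : R :=
  if l is l'.+1 then
    if (l < m)%N then Num.min (slope l') (fixed l) else slope l'
  else fixed 0.

Definition enough (l n : nat) : bool := (l < m)%N && (fixed l <= rate l * n%:R).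

Lemma rate_ge0 l : 0 <= rate l.
Proof.
case: l => [|l] /=; first exact: fixed_ge0.
by case: ifP => _; rewrite ?le_min ?slope_ge0 ?fixed_ge0.
Qed.

Lemma rate_fixed l : (l < m)%N -> rate l <= fixed l.
Proof. by case: l => [|l] //= ->; rewrite ge_min lexx orbT. Qed.

Lemma rate_slope l : rate l.+1 <= slope l.
Proof. by rewrite /=; case: ifP => // _; rewrite ge_min lexx. Qed.

Lemma enough0 n : (0 < n)%N -> enough 0 n.
Proof.
move=> n0; rewrite /enough kept_gt0 /= -[leLHS]mulr1 ler_wpM2l ?fixed_ge0 //.
by rewrite -[1]/(1%:R) ler_nat.
Qed.

Lemma enough_top n : enough m n = false.
Proof. by rewrite /enough ltnn. Qed.

(** If the minimum in [rate] were [fixed l.+1], a single terminal would be enough. *)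
Lemma not_enough_slope l n : (0 < n)%N -> ~~ enough l.+1 n ->
  slope l <= rate l.+1.
Proof.
move=> n0; rewrite /enough /=; case: ifP => //= lm.
case: (leP (slope l) (fixed l.+1)) => // _ /negP[].
by rewrite -[leLHS]mulr1 ler_wpM2l ?fixed_ge0 // -[1]/(1%:R) ler_nat.
Qed.

(* Net [m] is never extended; with at most [k] terminals, any bound of at least
   [rate m * k] acts as the missing fixed cost. *)
Definition cap (k l : nat) : R :=
  if (l < m)%N then fixed l else rate l * k.+1%:R.

Lemma rate_cap k l : rate l <= cap k l.
Proof.
rewrite /cap; case: ifP => [/rate_fixed//|_].
by rewrite -[leLHS]mulr1 ler_wpM2l ?rate_ge0 // -[1]/(1%:R) ler_nat.
Qed.

Lemma not_enough_cap k l n : (n <= k)%N -> ~~ enough l n ->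
  rate l * n%:R <= cap k l.
Proof.
rewrite /enough /cap => nk; case: ifP => _ /=.
  by rewrite -ltNge => /ltW.
by rewrite ler_wpM2l ?rate_ge0 // ler_nat leqW.
Qed.

(** The [Phi] of [cost_lower_bound]: what the layers together charge, per unit of length, to an edge
    with [n] users. *)
Definition layered (k n : nat) : R :=
  \sum_(0 <= l < m.+1) Num.min (cap k l) (rate l * n%:R).

Lemma cap_ge0 k l : 0 <= cap k l.
Proof. exact: le_trans (rate_ge0 l) (rate_cap k l). Qed.

Lemma layered0 k : layered k 0 = 0.
Proof.
by rewrite /layered big1 // => l _; rewrite mulr0 min_r // cap_ge0.
Qed.

Lemma layered_homo k : {homo layered k : n p / (n <= p)%N >-> n <= p}.
Proof.
move=> n p np; apply: ler_sum => l _; rewrite le_min !ge_min lexx /=.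
by rewrite ler_wpM2l ?orbT ?rate_ge0 // ler_nat.
Qed.

Lemma layeredD k n p : layered k (n + p)%N <= layered k n + layered k p.
Proof.
rewrite -big_split; apply: ler_sum => l _ /=; rewrite natrD mulrDr.
have c0 := cap_ge0 k l; set c := cap k l in c0 *.
have a0 : 0 <= rate l * n%:R by rewrite mulr_ge0 ?rate_ge0.
have b0 : 0 <= rate l * p%:R by rewrite mulr_ge0 ?rate_ge0.
by rewrite !minEle; do !case: ifPn; rewrite -?ltNge; lra.
Qed.

Lemma sum_fixed j : (j < m)%N -> \sum_(0 <= l < j.+1) fixed l <= 2 * fixed j.
Proof.
have f0 := fixed_ge0; elim: j => [|j IH] jm.
  by rewrite big_nat1; have := f0 0%N; lra.
rewrite big_nat_recr //=; have := IH (ltnW jm).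
by have := fixed_geometric jm; have := f0 j; lra.
Qed.

Lemma sum_slope j n : \sum_(j <= l < j + n) slope l <= 2 * slope j.
Proof.
have b0 := slope_ge0; elim: n j => [|n IH] j.
  by rewrite addn0 big_geq //; have := b0 j; lra.
rewrite addnS big_ltn ?ltnS ?leq_addr //; have := IH j.+1; rewrite addSn.
by have := slope_geometric j; have := b0 j; have := b0 j.+1; lra.
Qed.

(** Let layer [j] dominate [q]. Layers up to [j] are bounded by their fixed costs, summing to at
    most [2 * fixed j], later ones by the slopes from [j] on; domination costs the factor 8. *)
Lemma layered_le k (q : 'I_M) n : layered k n <= 16 * (sigma q + beta q * n%:R).
Proof.
have [i ik [si bi]] := kept_dominates q; have n0 : (0 : R) <= n%:R by [].
have jm : (index i kept < m)%N by rewrite index_mem.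
have jE : layer (index i kept) = i by rewrite /layer nth_index.
set j := index i kept in jm jE.
rewrite /layered (@big_cat_nat _ _ _ j.+1) //=; last exact: leqW.
have h1 : \sum_(0 <= l < j.+1) Num.min (cap k l) (rate l * n%:R) <= 2 * fixed j.
  apply: le_trans (sum_fixed jm); rewrite big_nat [leRHS]big_nat.
  apply: ler_sum => l /andP[_ lj]; rewrite /cap (leq_trans lj jm).
  by rewrite ge_min lexx.
have h2 : \sum_(j.+1 <= l < m.+1) Num.min (cap k l) (rate l * n%:R)
          <= 2 * slope j * n%:R.
  rewrite big_add1 /=.
  have := sum_slope j (m - j); rewrite subnKC ?(ltnW jm) // => hs.
  apply: le_trans (ler_wpM2r n0 hs); rewrite mulr_suml; apply: ler_sum => l _.
  by rewrite ge_min ler_wpM2r ?rate_slope // orbT.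
rewrite /slope jm jE in h2; rewrite /fixed jE in h1.
have : beta i * n%:R <= 8 * beta q * n%:R by rewrite ler_wpM2r.
by lra.
Qed.

End Layers.

(** * Competitive analysis *)

(** [inord] extends the matrix to all indices; by [decide_local] only the entries up to [n]
    matter. *)
Definition layered_algorithm (R : realType) : online_algorithm R :=
  fun K n A => map_decision (fun x : nat => inord x : 'I_n.+1)
    (decide (enough K) (size (kept K)) (layer K)
            (fun x y => A (inord x) (inord y)) n).

Section Analysis.
Context {R : realType} (K : cable_types R) {V : metricType R} (r : V).
Variable s : seq V.
Local Notation m := (size (kept K)).
Local Notation k := (size s).
Local Notation pt x := (nth r (r :: s) x).

Definition sdist (x y : nat) : R := mdist (pt x) (pt y).
Local Notation d := sdist.

Lemma sdist0 x : d x x = 0. Proof. exact: mdistxx. Qed.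
Lemma sdist_ge0 x y : 0 <= d x y. Proof. exact: mdist_ge0. Qed.
Lemma sdistC x y : d x y = d y x. Proof. exact: metric_sym. Qed.
Lemma sdistT x y z : d x z <= d x y + d y z. Proof. exact: metric_triangle. Qed.

Local Notation stepsP :=
  (stepsP sdist0 sdist_ge0 sdistC sdistT (@enough_top R K)).
Local Notation steps t := (steps (enough K) m d t).
Local Notation dec t := (decide (enough K) m (layer K) d t).
Local Notation routeP := (routeP (layer K) sdist0 sdist_ge0 sdistC sdistT
  (@enough0 R K) (@enough_top R K)).
Local Notation D := (run (@layered_algorithm R) K r s).

(** By locality, the online decisions are those computed from the full metric. *)
Lemma run_decision t : (t < k)%N ->
  nth (idle V _) D t = map_decision (fun x => pt x) (dec t.+1).
Proof.
move=> tk; rewrite nth_mkseq // /layered_algorithm.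
have ag : agree t.+1 d (fun x y => revealed r s t.+1 (inord x) (inord y)).
  by move=> x y xt yt; rewrite mxE !inordK // ltnS.
rewrite -(decide_local (layer K) sdist0 sdist_ge0 sdistC sdistT
            (@enough_top R K) ag).
rewrite /map_decision /=; congr Decision.
  rewrite -!map_comp; apply/eq_in_map => st.
  move=> /(steps_le sdist0 sdist_ge0 sdistC sdistT (@enough_top R K)).
  move=> /andP[s1 s2] /=.
  by rewrite !inordK // ltnS.
rewrite -map_comp; apply/eq_in_map => x xp /=.
have [_ _ /(_ x xp)[_ xt] _] := routeP t.+1.
by rewrite inordK // ltnS.
Qed.

Lemma pt_rep x : pt (rep d x) = pt x.
Proof. by apply/esym/mdist_positivity/(dist_rep sdist0). Qed.

Definition step_edge (st : nat * nat * nat) : V * V :=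
  edge (pt st.1.1) (pt st.1.2).

Lemma step_edge_length st : edge_length (step_edge st) = d st.1.1 st.1.2.
Proof. exact: edge_lengthE. Qed.

Lemma route_step t e : (t < k)%N -> e \in route_edges r s D t ->
  exists2 st, st \in steps t.+1 & e = step_edge st.
Proof.
move=> tk; rewrite /route_edges run_decision //.
rewrite -[route (map_decision _ _)]/([seq pt x | x <- route (dec t.+1)]).
have [_ _ _ ] := routeP t.+1; set p := route _.
rewrite -[nth r s t]/(pt t.+1) -pt_rep; move: p (rep d t.+1).
elim=> [x _|y p IH x /= /andP[/hasP[st stt /andP[/eqP<- /eqP<-]] pp]].
  by [].
rewrite inE => /orP[/eqP->|]; first by rewrite !pt_rep; exists st.
exact: IH.
Qed.

Lemma installedP t e i : (t < k)%N ->
  reflect (exists t' st, [/\ (t' <= t)%N, st \in steps t'.+1, e = step_edge st &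
                          i = layer K st.2])
          (installed D t e i).
Proof.
move=> tk; apply: (iffP existsP) => [[t' /hasP[c]]|[t' [st [tt stt -> ->]]]].
  rewrite run_decision; last by apply: leq_trans tk; rewrite ltn_ord.
  case/mapP=> c' /mapP[st stt ->] -> /= /andP[/eqP <- /eqP <-].
  by exists t', st; split => //; rewrite -ltnS.
exists (Ordinal (tt : (t' < t.+1)%N)); apply/hasP.
exists (pt st.1.1, pt st.1.2, layer K st.2); last by rewrite /= !eqxx.
rewrite run_decision /=; last exact: leq_ltn_trans tk.
apply/mapP; exists (st.1.1, st.1.2, layer K st.2) => //.
by apply/mapP; exists st.
Qed.

Lemma run_solution : solution r s D.
Proof.
split; first by rewrite size_mkseq.
move=> t tk v p.
have [up lp inp _] := routeP t.+1.
rewrite /p run_decision //; set q := route _ in up lp inp *.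
have vE : v = pt (rep d t.+1) by rewrite pt_rep.
have -> : v :: route (map_decision (fun x => pt x) (dec t.+1)) =
          [seq pt x | x <- rep d t.+1 :: q] by rewrite vE.
split.
- rewrite map_inj_in_uniq // => x y.
  have isrep z : z \in rep d t.+1 :: q -> rep d z = z.
    rewrite inE => /orP[/eqP->|/inp[]//].
    apply: (rep_eq sdist0 sdist_ge0 sdistC sdistT).
    by rewrite sdistC (dist_rep sdist0).
  move=> /isrep xr /isrep yr E; rewrite -xr -yr.
  apply: (rep_inj sdist0 sdist_ge0 sdistC sdistT).
  by rewrite xr yr /sdist E mdistxx.
- by rewrite vE last_map lp.
move=> e /(route_step tk)[st stt ->]; exists (layer K st.2).
by apply/installedP => //; exists t, st.
Qed.

(** The common currency: it bounds the cost of the algorithm from above and is in turn bounded by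
    any solution. *)
Definition net_cost (l : nat) : R :=
  rate K l * \sum_(1 <= c < k.+1) up2 (reach (net (enough K l) d c)).

Local Notation U :=
  (undup (flatten [seq route_edges r s D t | t <- iota 0 k])).
Local Notation pairs := [seq (e, i) | e <- U, i <- index_enum 'I_(ntypes K)].

Lemma uniq_pairs : uniq pairs.
Proof.
apply: allpairs_uniq; rewrite ?undup_uniq ?index_enum_uniq //.
by move=> [? ?] [? ?].
Qed.

(** A pair with positive load was bought by some step. Those of positive length lie in
    [layer_steps], and [credit] pays for their total length. *)
Lemma fixed_cost :
  \sum_(a <- pairs) (if (0 < load r s D a.1 a.2)%N
                     then edge_length a.1 * sigma a.2 else 0) <=
  17 * \sum_(0 <= l < m) net_cost l.
Proof.
pose W := [seq (st, l) | l <- iota 0 m,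
             st <- layer_steps d (enough K l) (enough K l.+1) k].
apply: (@le_trans _ _ (\sum_(w <- W) fixed K w.2 * d w.1.1 w.1.2)).
  apply: (@sum_cover _ _ _ _ _
            (fun a w => a == (step_edge w, layer K w.2))).
  - exact: uniq_pairs.
  - by move=> w _; rewrite mulr_ge0 ?fixed_ge0 ?sdist_ge0.
  - by move=> w _ a a' _ _ /eqP-> /eqP->.
  move=> [e i] _ /=; case: ifP => [|_]; last by left.
  rewrite -has_count => /hasP[t]; rewrite mem_iota => /= tk /andP[_ /andP[+ _]].
  case/installedP => // t' [st [tt stt -> ->]].
  have [_ _ /(_ st stt)[lm cs]] := stepsP t'.+1.
  rewrite step_edge_length.
  have tk' : (0 < t'.+1 <= k)%N by exact: leq_ltn_trans tk.
  have [->|stl] := layer_stepsP sdist0 sdist_ge0 tk' cs.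
    by left; rewrite mul0r.
  right; exists st; last by rewrite eqxx mulrC.
  apply/allpairsPdep; exists st.2, st.1; split=> //; last by case: (st).
  by rewrite mem_iota.
rewrite big_allpairs_dep /= /index_iota subn0 mulr_sumr.
rewrite big_seq [leRHS]big_seq; apply: ler_sum => l; rewrite mem_iota => /= lm.
rewrite -mulr_sumr.
have := layer_steps_length sdist0 (enough K l) (enough K l.+1) k.
move=> /(ler_wpM2l (fixed_ge0 K l)) /le_trans; apply.
rewrite mulrCA ler_wpM2l // /net_cost.
apply: (credit sdist0 sdist_ge0 sdistC sdistT) => [|n /andP[]//].
exact: rate_ge0.
Qed.

(** The gap to net [l.+1] is 0 if [t] is open there; otherwise it is at most the scale, and, unless
    the scale is 0, [slope l <= rate l.+1] because [t] did not open. *)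
Lemma rent_cost t : (0 < t)%N ->
  \sum_(st <- steps t) slope K st.2 * d st.1.1 st.1.2 <=
  6 * \sum_(0 <= l < m) rate K l.+1 * up2 (reach (net (enough K l.+1) d t)).
Proof.
move=> t0; have [Hx _] := targetP d (enough K 0) t t.
have := ascend_rent sdist0 sdist_ge0 sdistC sdistT m (leqnn t) (slope_ge0 K)
  (slope_geometric K) (target_le _ _ _ _) Hx.
rewrite (start_dist sdist0 sdist_ge0 (@enough0 R K)) mulr0 addr0 add0n.
move=> /le_trans; apply; rewrite ler_wpM2l //; apply: ler_sum => l _.
set g := gap _ _ _ _; set E := up2 _.
have R0 : 0 <= rate K l.+1 * E by rewrite mulr_ge0 ?rate_ge0 ?up2_ge0.
have gE : g <= E.
  apply: le_trans (up2_ge _); rewrite reachE; last exact: sdist0.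
  by apply: gap_le; [exact: parent_le|exact: opened_parent].
have g0 : 0 <= g by exact: sdist_ge0.
have [Ht|nHt] := boolP (opened (net (enough K l.+1) d t)).
  suff -> : g = 0 by rewrite mulr0.
  by apply/eqP; rewrite eq_le g0 andbT -(sdist0 t) gap_le.
have [D0|D0] := ltP 0 (reach (net (enough K l.+1) d t)); last first.
  move: gE; rewrite /E up2_npos // => gE.
  by have -> : g = 0; [apply/eqP; rewrite eq_le gE|rewrite !mulr0].
move: nHt; rewrite (openedE _ sdist0) // D0 /= => /not_enough_slope h.
apply: (@le_trans _ _ (rate K l.+1 * g)).
  rewrite ler_wpM2r // h // -has_count; apply/hasP; exists t.
    by rewrite mem_iota t0 add1n ltnSn.
  by rewrite /near_class eqxx sdist0 divr_ge0 ?up2_ge0.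
by rewrite ler_wpM2l ?rate_ge0.
Qed.

(** The cable used is at least as high as the one bought by the step, so its [beta] is no larger;
    being highest, it is unique for each edge. *)
Lemma incremental_cost t : (t < k)%N ->
  \sum_(a <- pairs) (if (a.1 \in route_edges r s D t) &&
                        highest_installed D t a.1 a.2
                     then edge_length a.1 * beta a.2 else 0) <=
  \sum_(st <- steps t.+1) slope K st.2 * d st.1.1 st.1.2.
Proof.
move=> tk; apply: (@sum_cover _ _ _ _ _
  (fun a w => (a.1 == step_edge w) && highest_installed D t a.1 a.2)).
- exact: uniq_pairs.
- by move=> w _; rewrite mulr_ge0 ?slope_ge0 ?sdist_ge0.
- move=> w _ [e i] [e' i'] _ _ /andP[/= /eqP-> /andP[hi /forallP mi]].
  move=> /andP[/= /eqP-> /andP[hi' /forallP mi']]; congr (_, _).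
  apply/val_inj/eqP; rewrite eqn_leq.
  by rewrite (implyP (mi' i) hi) (implyP (mi i') hi').
move=> [e i] _ /=; case: ifP => [/andP[et hi]|_]; last by left.
have [st stt ee] := route_step tk et.
right; exists st => //; rewrite ee eqxx -ee hi; split=> //.
rewrite ee step_edge_length mulrC ler_wpM2r ?sdist_ge0 //.
have [_ _ /(_ st stt)[lm _]] := stepsP t.+1; rewrite /slope lm.
apply: beta_le; have /andP[_ /forallP/(_ (layer K st.2))/implyP] := hi.
by apply; apply/installedP => //; exists t, st.
Qed.

(** Fixed costs take 17 times nets [0] to [m - 1], incremental costs 6 times nets [1] to [m]. *)
Lemma run_cost : cost r s D <= 23 * \sum_(0 <= l < m.+1) net_cost l.
Proof.
have net0 l : 0 <= net_cost l.
  by rewrite mulr_ge0 ?rate_ge0 // sumr_ge0 // => c _; rewrite up2_ge0.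
have -> : cost r s D =
  \sum_(a <- pairs) (if (0 < load r s D a.1 a.2)%N
                     then edge_length a.1 * sigma a.2 else 0) +
  \sum_(t <- iota 0 k) \sum_(a <- pairs)
     (if (a.1 \in route_edges r s D t) && highest_installed D t a.1 a.2
      then edge_length a.1 * beta a.2 else 0).
  rewrite [X in _ + X]exchange_big /= !big_allpairs -big_split /=.
  apply: eq_bigr => e _; rewrite -big_split /= mulr_sumr big_mkcond /=.
  apply: eq_bigr => i _.
  have -> : \sum_(t <- iota 0 k)
     (if (e \in route_edges r s D t) && highest_installed D t e i
      then edge_length e * beta i else 0) =
     edge_length e * beta i * (load r s D e i)%:R.
    rewrite -big_mkcond big_const_seq iter_addr_0 -[LHS]mulr_natr.
    by [].
  case: posnP => [->|_]; first by rewrite mulr0 addr0.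
  by rewrite mulrDr mulrA.
have h1 := fixed_cost.
have h2 : \sum_(t <- iota 0 k) \sum_(a <- pairs)
     (if (a.1 \in route_edges r s D t) && highest_installed D t a.1 a.2
      then edge_length a.1 * beta a.2 else 0) <=
  6 * \sum_(0 <= l < m) net_cost l.+1.
  apply: (@le_trans _ _ (\sum_(t <- iota 0 k) 6 * \sum_(0 <= l < m)
      rate K l.+1 * up2 (reach (net (enough K l.+1) d t.+1)))).
    rewrite big_seq [leRHS]big_seq; apply: ler_sum => t.
    rewrite mem_iota => /= tk.
    exact: le_trans (incremental_cost tk) (rent_cost _).
  rewrite -mulr_sumr ler_wpM2l // exchange_big /=; apply: ler_sum => l _.
  by rewrite /net_cost -mulr_sumr big_add1 /index_iota subn0.
have e1 : \sum_(0 <= l < m.+1) net_cost l =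
          \sum_(0 <= l < m) net_cost l + net_cost m.
  by rewrite big_nat_recr.
have e2 : \sum_(0 <= l < m.+1) net_cost l =
          net_cost 0 + \sum_(0 <= l < m) net_cost l.+1.
  by rewrite big_nat_recl.
by have := net0 0%N; have := net0 m; lra.
Qed.

(** The bounds for the single layers are added edge by edge before comparing with the cost, so the
    number of layers does not enter. *)
Lemma net_cost_lower_bound (D' : seq (decision V (ntypes K))) :
  solution r s D' ->
  \sum_(0 <= l < m.+1) net_cost l <=
  (trunc_log 2 k).+2%:R * (128 * (16 * cost r s D')).
Proof.
move=> sol.
pose U' := undup (flatten [seq route_edges r s D' t | t <- iota 0 k]).
have low := @cost_lower_bound R V K r s D' sol (layered K k) 16 (ler0n _ _)
  (layered0 K k) (@layered_homo R K k) (@layeredD R K k)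
  (fun q n _ => layered_le k q n).
apply: (@le_trans _ _ ((trunc_log 2 k).+2%:R *
  (128 * \sum_(e <- U') edge_length e * layered K k (usage r s D' e)))).
  under [in leRHS]eq_bigr do rewrite mulr_sumr.
  rewrite exchange_big /= !mulr_sumr; apply: ler_sum => l _.
  apply: (layer_lower_bound sol); [exact: rate_ge0|exact: rate_cap|].
  by move=> n; exact: not_enough_cap.
by rewrite !ler_wpM2l.
Qed.

End Analysis.

Lemma trunc_log_bigO (R : realType) (c : R) :
  (fun k : nat => c * (trunc_log 2 k).+2%:R : R) =O_\oo
  (fun k : nat => ln (k%:R : R)).
Proof.
have ln2 : (0 : R) < ln 2 by rewrite ln_gt0 // ltr1n.
apply/eqO_exP; exists (3 * (`|c| + 1) / ln 2).
  by rewrite divr_gt0 // mulr_gt0 // ltr_wpDl.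
near=> k; have k2 : (2 <= k)%N by near: k; exact: nbhs_infty_ge.
set t := trunc_log 2 k.
(* From [t >= 1] follows [t + 2 <= 3 * t], the source of the constant 3. *)
have t1 : (1 : R) <= t%:R by rewrite ler1n trunc_log_max.
have lnk : t%:R * ln 2 <= ln (k%:R : R).
  have k0 : (0 < k)%N by exact: ltnW.
  rewrite mulr_natl -lnXn // ler_ln ?posrE ?exprn_gt0 ?ltr0n //.
  by rewrite -natrX ler_nat trunc_logP.
have lnk0 : 0 <= ln (k%:R : R) by apply: le_trans lnk; rewrite mulr_ge0 // ltW.
have tk : t.+2%:R <= 3 * (ln (k%:R : R) / ln 2).
  move: lnk; rewrite -ler_pdivlMr // -addn2 natrD => lnk; lra.
rewrite /= normrM (@ger0_norm _ t.+2%:R) // (ger0_norm lnk0).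
rewrite [leRHS](_ : _ = (`|c| + 1) * (3 * (ln k%:R / ln 2))); last by ring.
by apply: ler_pM => //; rewrite lerDl.
Unshelve. all: by end_near.
Qed.

Theorem theorem1 (R : realType) :
  exists (A : online_algorithm R) (rho : nat -> R),
    rho =O_\oo (fun k : nat => ln (k%:R : R)) /\ competitive A rho.
Proof.
exists (@layered_algorithm R), (fun k => 23 * (128 * 16) * (trunc_log 2 k).+2%:R).
split; first exact: trunc_log_bigO.
move=> K V r s; have sol := run_solution K r s; split=> //.
set D := run _ K r s in sol *; set L := (trunc_log 2 (size s)).+2%:R : R.
have L0 : 0 < 23 * (128 * 16) * L.
  by do !apply: mulr_gt0; rewrite ltr0n.
(* Dividing by the ratio reduces the claim to a lower bound on the cost of each solution, as [opt]
   is an infimum over a nonempty set. *)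
rewrite mulrC -ler_pdivrMr //; apply: lb_le_inf.
  by exists (cost r s D), D.
move=> _ [D' sol' <-]; rewrite ler_pdivrMr //.
apply: le_trans (run_cost K r s) _.
rewrite [leRHS]mulrC -!mulrA; apply: ler_wpM2l; first by rewrite ler0n.
apply: le_trans (net_cost_lower_bound sol') _.
by rewrite -/L [leLHS]mulrCA [L * _]mulrCA.
Qed.
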